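(* Let $G$ be a simply connected five dimensional nilpotent Lie group with a left invariant Riemannian metric $\tilde a$, whose Lie algebra $\mathfrak l_{5,7}$ has an $\tilde a$-orthonormal basis $\{E_1,\dots,E_5\}$ with non-zero brackets $[E_1,E_2]=aE_3+bE_4+cE_5$, $[E_1,E_3]=dE_4+fE_5$, $[E_1,E_4]=gE_5$, where $a,d,g>0$ and either $b>0$, or $b=0$ and $f\ge0$. Let $F$ be a left invariant non-Riemannian Randers metric of Douglas type on $G$, induced by $\tilde a$ and a left invariant vector field $X=\lambda_1E_1+\lambda_2E_2$. Then the $S$-curvature of $F$ is given by $$S(Y)=3\left\{\frac{(y_1\lambda_2-y_2\lambda_1)(ay_3+by_4+cy_5)-\lambda_1y_3(dy_4+fy_5)-\lambda_1gy_4y_5}{F(Y)}\right\},$$ where $Y=y_1E_1+y_2E_2+y_3E_3+y_4E_4+y_5E_5$ (non-zero).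
   Context: Brackets of basis elements not listed (and not obtained by antisymmetry) are zero. The Randers metric induced by $\tilde a$ and $X$, where $\sqrt{\tilde a(X,X)}<1$, is $F(x,y)=\sqrt{\tilde a(y,y)}+\tilde a(X(x),y)$. The spray coefficients of $F$ in standard local coordinates $(x,y)$ of the tangent bundle are $G^i=\frac14 g^{il}\big([F^2]_{x^my^l}y^m-[F^2]_{x^l}\big)$, where $g_{ij}=\frac12\frac{\partial^2F^2}{\partial y^i\partial y^j}$. $F$ is of Douglas type if in every standard local coordinate system $G^i=\frac12\Gamma^i_{jk}(x)y^jy^k+P(x,y)y^i$ for some functions $\Gamma^i_{jk}(x)$ and some local function $P(x,y)$ positively homogeneous of degree one in $y$. The $S$-curvature (Shen), with respect to the Busemann–Hausdorff volume form $\sigma(x)\,dx^1\cdots dx^n$, $\sigma(x)=\mathrm{Vol}(\text{unit ball of }\mathbb R^n)/\mathrm{Vol}\{(y^i)\in\mathbb R^n: F(x,y^i\partial_{x^i})<1\}$, is $S(x,y)=\frac{\partial G^m}{\partial y^m}(x,y)-y^m\frac{\partial\ln\sigma}{\partial x^m}(x)$; $S(Y)$ denotes $S(e,Y)$ and $F(Y)$ denotes $F(e,Y)$ for $Y$ in the Lie algebra $T_eG$. *)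

(* Defs.v *)
From HB Require Import structures.
From mathcomp Require Import all_boot all_order all_algebra.
From mathcomp Require Import all_classical all_reals all_analysis.

Set Implicit Arguments.
Unset Strict Implicit.
Unset Printing Implicit Defensive.

Import Order.TTheory GRing.Theory Num.Theory.
Import numFieldNormedType.Exports.

Local Open Scope classical_set_scope.
Local Open Scope ring_scope.

(* f is of class C^k on the open set U: on finite-dimensional V, existence and
   continuity of all iterated directional derivatives up to order k. *)
Fixpoint Ck_on (R : realType) (V W : normedModType R) (k : nat) (U : set V)
    (f : V -> W) : Prop :=
  (forall x, U x -> {for x, continuous f}) /\
  match k with
  | 0 => True
  | k'.+1 => forall v, (forall x, U x -> derivable f x v) /\ Ck_on k' U ('D_v f)
  end.

Definition smooth_on (R : realType) (V W : normedModType R) (U : set V)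
    (f : V -> W) : Prop :=
  forall k, Ck_on k U f.

(* chart_map is only relevant on chart_dom, and chart_inv only on the image of
   chart_dom. *)
Record chart (R : realType) (n : nat) (M : topologicalType) := Chart {
  chart_dom : set M;
  chart_map : M -> 'rV[R]_n;
  chart_inv : 'rV[R]_n -> M;
  chart_dom_open : open chart_dom;
  chart_cod_open : open (chart_map @` chart_dom);
  chart_mapK : forall p, chart_dom p -> chart_inv (chart_map p) = p;
  chart_map_continuous : forall p, chart_dom p -> {for p, continuous chart_map};
  chart_inv_continuous : forall x, (chart_map @` chart_dom) x ->
    {for x, continuous chart_inv} }.

Section Charts.
Context {R : realType} {n : nat} {M : topologicalType}.

Definition chart_cod (c : chart R n M) : set 'rV[R]_n :=
  chart_map c @` chart_dom c.

(* The map f read in the charts c and c', and the set where it is defined. *)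
Definition local_map (f : M -> M) (c c' : chart R n M) : 'rV[R]_n -> 'rV[R]_n :=
  fun x => chart_map c' (f (chart_inv c x)).

Definition local_dom (f : M -> M) (c c' : chart R n M) : set 'rV[R]_n :=
  chart_map c @` [set p | chart_dom c p /\ chart_dom c' (f p)].

Definition compatible (c c' : chart R n M) : Prop :=
  smooth_on (local_dom id c c') (local_map id c c').

End Charts.

HB.mixin Record Topological_isManifold (R : realType) (n : nat) M
    of Topological M := {
  atlas : set (chart R n M);
  atlas_cover : forall p, exists2 c, atlas c & chart_dom c p;
  atlas_compatible : forall c c', atlas c -> atlas c' -> compatible c c';
  atlas_maximal : forall c,
    (forall c', atlas c' -> compatible c c' /\ compatible c' c) -> atlas c;
  manifold_hausdorff : hausdorff_space M;
  manifold_second_countable : @second_countable M }.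

#[short(type="manifoldType")]
HB.structure Definition Manifold (R : realType) (n : nat) :=
  {M of Topological_isManifold R n M & Topological M}.

HB.mixin Record ManifoldGroup_isLieGroup (R : realType) (n : nat) G
    of Manifold R n G & Group G := {
  mul_continuous : continuous (fun z : G * G => (z.1 * z.2)%g);
  inv_continuous : continuous (fun p : G => (p^-1)%g);
  mul_smooth : forall c1 c2 c3 : chart R n G,
    atlas c1 -> atlas c2 -> atlas c3 ->
    smooth_on
      [set z : 'rV[R]_n * 'rV[R]_n | [/\ chart_cod c1 z.1, chart_cod c2 z.2 &
         chart_dom c3 (chart_inv c1 z.1 * chart_inv c2 z.2)%g]]
      (fun z => chart_map c3 (chart_inv c1 z.1 * chart_inv c2 z.2)%g);
  inv_smooth : forall c c' : chart R n G, atlas c -> atlas c' ->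
    smooth_on (local_dom (fun p : G => (p^-1)%g) c c')
      (local_map (fun p : G => (p^-1)%g) c c') }.

#[short(type="lieGroupType")]
HB.structure Definition LieGroup (R : realType) (n : nat) :=
  {G of ManifoldGroup_isLieGroup R n G & Manifold R n G & Group G}.

Definition simply_connected (R : realType) (M : topologicalType) : Prop :=
  (forall p q : M, exists gamma : R -> M,
     [/\ {within `[0, 1], continuous gamma}, gamma 0 = p & gamma 1 = q]) /\
  (forall gamma : R -> M,
     {within `[0, 1], continuous gamma} -> gamma 0 = gamma 1 ->
     exists H : R * R -> M,
       [/\ {within `[0, 1] `*` `[0, 1], continuous H},
           forall s, s \in `[0, 1] -> H (0, s) = gamma s,
           forall s, s \in `[0, 1] -> H (1, s) = gamma 0 &
           forall t, t \in `[0, 1] -> H (t, 0) = gamma 0 /\ H (t, 1) = gamma 0]).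

Definition is_subgroup (G : groupType) (H : set G) : Prop :=
  [/\ H 1%g, forall x y, H x -> H y -> H (x * y)%g &
      forall x, H x -> H (x^-1)%g].

Definition generated_subgroup (G : groupType) (A : set G) : set G :=
  [set x | forall H, is_subgroup H -> A `<=` H -> H x].

Fixpoint lower_central_series (G : groupType) (k : nat) : set G :=
  match k with
  | 0 => [set: G]
  | k'.+1 => generated_subgroup
      [set z | exists x y : G, @lower_central_series G k' x /\ z = commg x y]
  end.

Definition nilpotent_group (G : groupType) : Prop :=
  exists k, @lower_central_series G k = [set 1%g].

(* Tensor fields are families of local components, one for each chart c and
   each coordinate vector x in chart_cod c, related by the tangent maps
   v |-> 'D_v tau x of the transition maps tau.  Values at charts outside the
   atlas or at points outside chart_cod c are irrelevant. *)
Section Fields.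
Context {R : realType} {n : nat} (M : manifoldType R n).
Local Notation V := 'rV[R]_n.
Local Notation chart := (chart R n M).

Definition vfield := chart -> V -> V.
Definition tensor2 := chart -> V -> 'M[R]_n.
(* Functions on the tangent bundle, in the standard coordinates (x, y). *)
Definition tangent_fun := chart -> V -> V -> R.

Definition eq_field (X Y : vfield) : Prop :=
  forall c : chart, atlas c -> forall x, chart_cod c x -> X c x = Y c x.

Definition pairing (h : tensor2) (c : chart) (x v w : V) : R :=
  (v *m h c x *m w^T) 0 0.

Definition field_preserved (f : M -> M) (X : vfield) : Prop :=
  forall c c' : chart, atlas c -> atlas c' -> forall x, local_dom f c c' x ->
    X c' (local_map f c c' x) = 'D_(X c x) (local_map f c c') x.

Definition tensor2_preserved (f : M -> M) (h : tensor2) : Prop :=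
  forall c c' : chart, atlas c -> atlas c' -> forall x, local_dom f c c' x ->
    forall v w, pairing h c' (local_map f c c' x)
      ('D_v (local_map f c c') x) ('D_w (local_map f c c') x) =
    pairing h c x v w.

Definition tangent_fun_preserved (f : M -> M) (F : tangent_fun) : Prop :=
  forall c c' : chart, atlas c -> atlas c' -> forall x, local_dom f c c' x ->
    forall y, F c' (local_map f c c' x) ('D_y (local_map f c c') x) = F c x y.

Definition vector_field (X : vfield) : Prop :=
  (forall c : chart, atlas c -> smooth_on (chart_cod c) (X c)) /\
  field_preserved id X.

Definition riemannian_metric (h : tensor2) : Prop :=
  [/\ forall c : chart, atlas c -> smooth_on (chart_cod c) (h c),
      forall c : chart, atlas c -> forall x, chart_cod c x -> (h c x)^T = h c x,
      forall c : chart, atlas c -> forall x, chart_cod c x ->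
        forall v, v != 0 -> 0 < pairing h c x v v &
      tensor2_preserved id h].

Definition lie_bracket (X Y : vfield) : vfield :=
  fun c x => 'D_(X c x) (Y c) x - 'D_(Y c x) (X c) x.

Definition riemannian_norm (h : tensor2) : tangent_fun :=
  fun c x y => Num.sqrt (pairing h c x y y).

Definition randers (h : tensor2) (X : vfield) : tangent_fun :=
  fun c x y => riemannian_norm h c x y + pairing h c x (X c x) y.

Definition is_riemannian (F : tangent_fun) : Prop :=
  exists2 h, riemannian_metric h &
    forall c : chart, atlas c -> forall x, chart_cod c x ->
    forall y, F c x y = riemannian_norm h c x y.

End Fields.

Section LocalFinsler.
Context {R : realType} {n : nat}.
Local Notation V := 'rV[R]_n.
Local Notation "''e_' i" := (delta_mx 0 i : V) (at level 8, i at level 2).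
Implicit Types (F : V -> V -> R) (x y : V).

Definition fundamental_tensor F x y : 'M[R]_n :=
  \matrix_(i, j) (2^-1 *
    'D_'e_i (fun u => 'D_'e_j (fun v => F x v ^+ 2) u) y).

Definition spray_coef F (i : 'I_n) x y : R :=
  4^-1 * \sum_l invmx (fundamental_tensor F x y) i l *
    (\sum_m 'D_'e_l (fun v => 'D_'e_m (fun u => F u v ^+ 2) x) y * y 0 m
     - 'D_'e_l (fun u => F u y ^+ 2) x).

End LocalFinsler.

(* The iterated integral computing the n-fold product of the Lebesgue measure
   of R (with 'rV_0 a point of mass 1), i.e. Lebesgue measure on Borel sets;
   the library has no measure on 'rV[R]_n. *)
Fixpoint volume (R : realType) (n : nat) : set 'rV[R]_n -> \bar R :=
  match n with
  | 0 => fun A => (\1_A (0 : 'rV[R]_0) : R)%:E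
  | n'.+1 => fun A =>
      (\int[@lebesgue_measure R]_t
         volume [set v : 'rV[R]_n' | A (row_mx (t%:M : 'rV[R]_1) v)])%E
  end.

Section LocalSCurvature.
Context {R : realType} {n : nat}.
Local Notation V := 'rV[R]_n.
Local Notation "''e_' i" := (delta_mx 0 i : V) (at level 8, i at level 2).
Implicit Types (F : V -> V -> R) (x y : V).

Definition busemann_hausdorff F x : R :=
  fine (volume [set v : V | \sum_i v 0 i ^+ 2 < 1]) /
  fine (volume [set v : V | F x v < 1]).

Definition S_curvature F x y : R :=
  \sum_m 'D_'e_m (fun v => spray_coef F m x v) y
  - \sum_m y 0 m * 'D_'e_m (fun u => ln (busemann_hausdorff F u)) x.

End LocalSCurvature.

Definition douglas_type (R : realType) (n : nat) (M : manifoldType R n)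
    (F : tangent_fun M) : Prop :=
  forall c : chart R n M, atlas c ->
  exists (Gamma : 'I_n -> 'I_n -> 'I_n -> 'rV[R]_n -> R)
         (P : 'rV[R]_n -> 'rV[R]_n -> R),
  forall x, chart_cod c x -> forall y, y != 0 ->
    (forall t, 0 < t -> P x (t *: y) = t * P x y) /\
    forall i, spray_coef (F c) i x y =
      2^-1 * (\sum_j \sum_k Gamma i j k x * y 0 j * y 0 k) + P x y * y 0 i.

Section LeftInvariance.
Context {R : realType} {n : nat} (G : lieGroupType R n).

Definition left_invariant_field (X : vfield G) : Prop :=
  vector_field X /\ forall g : G, field_preserved (fun p => (g * p)%g) X.

Definition left_invariant_metric (h : tensor2 G) : Prop :=
  riemannian_metric h /\
  forall g : G, tensor2_preserved (fun p => (g * p)%g) h.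

Definition left_invariant_finsler (F : tangent_fun G) : Prop :=
  forall g : G, tangent_fun_preserved (fun p => (g * p)%g) F.

(* The inner product on the Lie algebra is the metric at the identity; n
   orthonormal left invariant fields form a basis of the Lie algebra, which
   has dimension n. *)
Definition orthonormal_basis (h : tensor2 G) (E : n.-tuple (vfield G)) : Prop :=
  (forall i, left_invariant_field (tnth E i)) /\
  forall c : chart R n G, atlas c -> chart_dom c 1%g -> forall i j,
    pairing h c (chart_map c 1%g)
      (tnth E i c (chart_map c 1%g)) (tnth E j c (chart_map c 1%g)) =
    (i == j)%:R.

End LeftInvariance.

(* Main.v *)
Require Import Defs.
From HB Require Import structures.
From mathcomp Require Import all_boot all_order all_algebra.
From mathcomp Require Import all_classical all_reals all_analysis.
From mathcomp Require Import perm measurable_realfun ring lra.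
Set Implicit Arguments.
Unset Strict Implicit.
Unset Printing Implicit Defensive.
Import Order.TTheory GRing.Theory Num.Theory.
Import numFieldNormedType.Exports.
Local Open Scope classical_set_scope.
Local Open Scope ring_scope.

(** Write F = alpha + beta with alpha the norm of h and beta = h(X, .).  Three
    facts give the formula.

    If beta is closed, the spray of F is G = G_alpha + P y, where G_alpha is the
    spray of h and P = r_00 / (2 F), r_00 being the covariant derivative of beta
    along y evaluated at y ([spray_coef_randers]).  One checks that the
    fundamental tensor maps this candidate to the right-hand side of the spray
    equation; the fundamental tensor is invertible ([randers_metric_unit]).
    Taking the vertical divergence, P y contributes (n + 1) P by Euler's identity
    and G_alpha contributes tr (h^-1 d_y h) / 2 ([div_spray_coef]).

    The unit ball of F at a point is an ellipsoid, of volume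
    const / (sqrt (det h) (1 - |X|^2)^((n + 1) / 2)) ([volume_randers_ball]).
    As the volume is an iterated integral, it is computed by slicing: completing
    the square shows that the slices of an ellipsoid are ellipsoids
    ([bform_slice]), and only affine substitutions in one variable are left
    ([volume_ellipsoid]).  When |X| is constant, ln sigma is therefore
    ln (det h) / 2 up to a constant; by Jacobi's formula its derivative cancels
    the divergence of G_alpha, and S = (n + 1) r_00 / (2 F)
    ([S_curvature_randers]).

    On the group, a basis of left invariant fields that is orthonormal at the
    identity is orthonormal everywhere ([orthonormal_basis_everywhere]), and X has
    constant coefficients in it, so |X| is constant.  Since beta is constant on
    the basis, d beta (E_i, E_j) = - beta [E_i, E_j]; this vanishes because X is
    orthogonal to all brackets ([closed_of_bracket]).  Finally r_00 (Y) =
    h ([Y, X], Y) because h (Y, Y) is constant for left invariant Y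
    ([r00_const_field]).  In dimension 5 this gives S = 3 h ([Y, X], Y) / F, and
    the bracket relations finish the computation. *)

(** * Symmetric bilinear forms and Schur complements *)

(** For q the matrix of a metric in a chart at a point, this is [pairing]. *)
Definition bform (R : realType) n (q : 'M[R]_n) (v w : 'rV[R]_n) : R :=
  (v *m q *m w^T) 0 0.

Definition posdef (R : realType) n (q : 'M[R]_n) : Prop :=
  q^T = q /\ forall v, v != 0 -> 0 < bform q v v.

Section Bform.
Context {R : realType} {n : nat}.
Implicit Types (q : 'M[R]_n) (v w u : 'rV[R]_n).

Lemma bformDl q v w u : bform q (v + w) u = bform q v u + bform q w u.
Proof. by rewrite /bform !mulmxDl mxE. Qed.

Lemma bformDr q v w u : bform q u (v + w) = bform q u v + bform q u w.
Proof. by rewrite /bform linearD/= mulmxDr mxE. Qed.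

Lemma bformZl q k v u : bform q (k *: v) u = k * bform q v u.
Proof. by rewrite /bform -!scalemxAl mxE. Qed.

Lemma bformZr q k v u : bform q u (k *: v) = k * bform q u v.
Proof. by rewrite /bform linearZ/= -scalemxAr mxE. Qed.

Lemma bformNl q v u : bform q (- v) u = - bform q v u.
Proof. by rewrite -scaleN1r bformZl mulN1r. Qed.

Lemma bformNr q v u : bform q u (- v) = - bform q u v.
Proof. by rewrite -scaleN1r bformZr mulN1r. Qed.

Lemma bform0l q u : bform q 0 u = 0.
Proof. by rewrite /bform !mul0mx mxE. Qed.

Lemma bform0r q u : bform q u 0 = 0.
Proof. by rewrite -(scale0r 0) bformZr mul0r. Qed.

Lemma bformC q v w : q^T = q -> bform q v w = bform q w v.
Proof.
move=> qT; rewrite /bform -[RHS](mxE trmx_key (fun i j => _ j i)).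
by rewrite -/(trmx _) trmx_mul trmxK trmx_mul qT mulmxA.
Qed.

Lemma posdef_unit q : posdef q -> q \in unitmx.
Proof.
move=> [_ qp]; rewrite -row_free_unit; apply/row_freeP.
suff : row_free q by move/row_freeP.
rewrite -kermx_eq0; apply/eqP/row_matrixP => i; rewrite row0.
apply/eqP; apply: contraT => /qp; rewrite /bform.
have /sub_kermxP -> := row_sub i (kermx q).
by rewrite mul0mx mxE ltxx.
Qed.

End Bform.

Section Schur.
Context {R : realType} {n : nat} (q : 'M[R]_(1 + n)).
Hypothesis qp : posdef q.

Let Q := drsubmx q.
Let p := ursubmx q *m invmx Q.
(** The Schur complement of the lower right block, obtained as the value of q on
    the vector with first coordinate 1 that is q-orthogonal to the last n
    coordinate directions. *)
Definition schur : R := bform q (row_mx 1%:M (- p)) (row_mx 1%:M (- p)).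

Lemma posdef_drsubmx : posdef (drsubmx q).
Proof.
case: qp => qT qpos; split; first by rewrite -[in RHS]qT trmx_drsub.
move=> v v0.
have := qpos (row_mx 0 v); rewrite row_mx_eq0 eqxx/= => /(_ v0).
rewrite /bform -[q in X in X -> _]submxK tr_row_mx mul_row_block mul_row_col.
by rewrite trmx0 mulmx0 add0r !mul0mx !add0r.
Qed.

Lemma schur_gt0 : 0 < schur.
Proof.
case: qp => _; apply; rewrite row_mx_eq0 negb_and.
apply/orP; left; apply/eqP => /matrixP /(_ 0 0) /eqP.
by rewrite !mxE eqxx oner_eq0.
Qed.

Lemma row_mx_schur (v : 'rV[R]_n) (Qu : Q \in unitmx) :
  row_mx (1%:M : 'rV[R]_1) (- p) *m q =
  row_mx (ulsubmx q - p *m dlsubmx q) 0.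
Proof.
rewrite -[q in LHS]submxK mul_row_block !mul1mx !mulNmx -/Q /p.
by rewrite -(mulmxA _ (invmx Q) Q) mulVmx// mulmx1 subrr.
Qed.

(** Completing the square in the last n coordinates: on each slice t = const the
    form is a translate of the same quadratic form, plus a constant. *)
Lemma bform_slice (t : R) (w : 'rV[R]_n) :
  bform q (row_mx t%:M w) (row_mx t%:M w) =
  schur * t ^+ 2 + bform Q (w + t *: p) (w + t *: p).
Proof.
have Qu : Q \in unitmx by apply/posdef_unit/posdef_drsubmx.
have -> : row_mx t%:M w =
    t *: row_mx (1%:M : 'rV[R]_1) (- p) + row_mx 0 (w + t *: p).
  by rewrite scale_row_mx add_row_mx addr0 scalerN (addrC (- _)) addrK scalemx1.
have cross : bform q (row_mx 1%:M (- p)) (row_mx 0 (w + t *: p)) = 0.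
  rewrite /bform row_mx_schur// tr_row_mx mul_row_col trmx0 mulmx0 mul0mx.
  by rewrite addr0 mxE.
move: (w + _) cross => u cross; rewrite !(bformDl, bformDr) !(bformZl, bformZr) cross.
rewrite [bform q (row_mx 0 _) (row_mx 1%:M _)]bformC ?cross; last by case: qp.
rewrite !mulr0 addr0 add0r -/schur mulrA -expr2 mulrC; congr (_ + _).
rewrite /bform -[q]submxK tr_row_mx mul_row_block mul_row_col.
by rewrite trmx0 mulmx0 add0r !mul0mx !add0r.
Qed.

(** A unipotent row operation clears the upper right block and leaves the Schur
    complement in the corner. *)
Lemma det_schur : \det q = schur * \det (drsubmx q).
Proof.
have Qu : Q \in unitmx by apply/posdef_unit/posdef_drsubmx.
pose U : 'M[R]_(1 + n) := block_mx 1%:M (- p) 0 1%:M.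
have dU : \det U = 1 by rewrite det_ublock !det1 mulr1.
rewrite -[LHS]mul1r -dU -det_mulmx.
have -> : U *m q = block_mx (schur%:M) 0 (dlsubmx q) Q.
  rewrite -[q in LHS]submxK mulmx_block !mul1mx !mul0mx !add0r !mulNmx.
  rewrite /p -(mulmxA _ (invmx Q) (drsubmx q)) mulVmx// mulmx1 subrr.
  congr (block_mx _ _ _ _).
  apply/matrixP => i j; rewrite !ord1 /schur /bform row_mx_schur//.
  by rewrite tr_row_mx mul_row_col mul0mx addr0 trmx1 mulmx1 [RHS]mxE eqxx mulr1n.
by rewrite det_lblock det_scalar1.
Qed.

End Schur.

Lemma posdef_det_gt0 (R : realType) n (q : 'M[R]_n) : posdef q -> 0 < \det q.
Proof.
elim: n q => [|n IH] q qp; first by rewrite det_mx00.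
by rewrite (@det_schur _ n)// mulr_gt0 ?schur_gt0// IH//; exact: posdef_drsubmx.
Qed.

(** * Volumes of ellipsoids *)

(** Lebesgue measure is determined by the lengths of intervals, so it coincides
    with k times its image under t |-> k (t - c). *)
Lemma lebesgue_integral_affine (R : realType) (f : R -> R) (k c : R) :
  0 < k -> measurable_fun setT f -> (forall t, 0 <= f t) ->
  (\int[@lebesgue_measure R]_t (f (k * (t - c)))%:E =
   k^-1%:E * \int[@lebesgue_measure R]_t (f t)%:E)%E.
Proof.
move=> k0 mf f0.
pose phi : measurableTypeR R -> measurableTypeR R := fun t => k * (t - c).
have mphi : measurable_fun setT phi.
  by apply: measurable_funM => //; apply: measurable_funB.
have kE : ((k^-1)%:E * (k%:E * \int[pushforward lebesgue_measure phi]_t (f t)%:E) =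
   \int[pushforward lebesgue_measure phi]_t (f t)%:E)%E.
  by rewrite muleA -EFinM mulVf ?gt_eqF// mul1e.
have f0E : forall t, setT t -> (0 <= (f t)%:E)%E by move=> t _; rewrite lee_fin.
have mfE : measurable_fun setT (EFin \o f) by exact/measurable_EFinP.
transitivity (\int[pushforward lebesgue_measure phi]_t (f t)%:E)%E.
  by rewrite ge0_integral_pushforward// => t _; rewrite lee_fin.
rewrite -kE; congr (_ * _)%E.
have := @ge0_integral_mscale _ _ _ (pushforward lebesgue_measure phi) _ (@measurableT _ _)
  (NngNum (ltW k0)) (EFin \o f) mfE f0E.
rewrite /= => <-.
apply: eq_measure_integral => A mA _; symmetry.
apply: lebesgue_measure_unique => // _ [[a b]] _ <-.
rewrite -[RHS]/(k%:E * lebesgue_measure (phi @^-1` `]a, b]%classic))%E.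
have -> : phi @^-1` `]a, b]%classic = `]a / k + c, b / k + c]%classic.
  apply/seteqP; split => t /=; rewrite !in_itv/= -ltrBrDr -lerBlDr /phi => /andP[h1 h2].
    by rewrite ltr_pdivrMr// mulrC h1/= ler_pdivlMr// mulrC.
  by rewrite mulrC -ltr_pdivrMr// h1/= -ler_pdivlMr.
rewrite !lebesgue_measure_itv/= !lte_fin ltrD2r ltr_pM2r ?invr_gt0//.
case: ifPn => _; last by rewrite mule0.
by rewrite -!EFinD -EFinM; congr (_%:E); field; rewrite gt_eqF.
Qed.

(** Up to a constant, the volume of the n-ball of squared radius r.  The case
    distinction matters for n = 0: the ball is empty for r <= 0, but a zeroth
    power is 1. *)
Definition ball_profile (R : realType) n (r : R) : R :=
  if 0 < r then Num.sqrt r ^+ n else 0.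

(** The ratio of the volumes of the unit balls of dimensions n + 1 and n. *)
Definition ball_factor (R : realType) n : R :=
  fine (\int[@lebesgue_measure R]_t (ball_profile n (1 - t ^+ 2))%:E).

Section BallFactor.
Context {R : realType}.

Lemma ball_profile_ge0 n (r : R) : 0 <= ball_profile n r.
Proof. by rewrite /ball_profile; case: ifP => // _; rewrite exprn_ge0// sqrtr_ge0. Qed.

Lemma ball_profile_scale n (k r : R) : 0 < k ->
  ball_profile n (k * r) = Num.sqrt k ^+ n * ball_profile n r.
Proof.
move=> k0; rewrite /ball_profile pmulr_rgt0//; case: ifPn => r0; last by rewrite mulr0.
by rewrite sqrtrM ?ltW// exprMn.
Qed.

Lemma measurable_ball_profile n :
  measurable_fun setT (fun t : R => ball_profile n (1 - t ^+ 2)).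
Proof.
have m2 : measurable_fun setT (fun t : R => 1 - t ^+ 2).
  by apply: measurable_funB => //; exact: exprn_measurable.
apply: measurable_fun_ifT => //.
  by apply: measurable_fun_ltr => //; exact: measurable_cst.
apply: measurable_funX; apply: measurableT_comp => //.
by apply: continuous_measurable_fun => r; exact: sqrt_continuous.
Qed.

Lemma integral_symmetric_indic (c : R) : 0 < c ->
  (\int[@lebesgue_measure R]_t (\1_(`[- c, c]%classic : set R) t)%:E)%E = (2 * c)%:E.
Proof.
move=> c0; rewrite integral_indic//= setIT.
have := lebesgue_measure_itv `[- c, c]; rewrite /= lte_fin ifT; last by lra.
by move=> ->; rewrite -EFinD; congr (_%:E); lra.
Qed.

(** The integrand lies between (1/2)^n times the indicator of [-1/2, 1/2] and the
    indicator of [-1, 1]. *)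
Lemma integral_ball_profile n :
  (\int[@lebesgue_measure R]_t (ball_profile n (1 - t ^+ 2))%:E)%E =
  (ball_factor R n)%:E /\ 0 < ball_factor R n.
Proof.
set I := (\int[_]_t _)%E.
have mB : measurable_fun setT (fun t : R => (ball_profile n (1 - t ^+ 2))%:E).
  by apply/measurable_EFinP; exact: measurable_ball_profile.
have leI : (I <= 2%:E)%E.
  have -> : 2%:E = (\int[@lebesgue_measure R]_t (\1_(`[-1, 1]%classic : set R) t)%:E)%E.
    by rewrite integral_symmetric_indic ?ltr01// mulr1.
  apply: ge0_le_integral => //.
  - by move=> t _; rewrite lee_fin ball_profile_ge0.
  - exact/measurable_EFinP/measurable_indic.
  - move=> t _; rewrite lee_fin /ball_profile; case: ifPn => // t1.
    have t2 : -1 <= t <= 1.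
      by rewrite -ler_norml -sqrtr_sqr -[X in _ <= X]sqrtr1 ler_sqrt; lra.
    rewrite indicE mem_set ?in_itv//= exprn_ile1 ?sqrtr_ge0//.
    by rewrite -[X in _ <= X]sqrtr1 ler_sqrt// lerBlDr lerDl sqr_ge0.
have geI : (((2^-1 : R) ^+ n)%:E <= I)%E.
  have -> : ((2^-1 : R) ^+ n)%:E = (\int[@lebesgue_measure R]_t
      ((2^-1 : R) ^+ n * \1_(`[- 2^-1, 2^-1]%classic : set R) t)%:E)%E.
    under eq_integral do rewrite EFinM.
    rewrite ge0_integralZl_EFin//; last by apply/measurable_EFinP.
    by rewrite integral_symmetric_indic ?invr_gt0// -EFinM mulfV// mulr1.
  apply: ge0_le_integral => //.
  - by apply/measurable_EFinP; apply: measurable_funM => //.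
  - move=> t _; rewrite lee_fin indicE; case: (boolP (_ \in _)).
      rewrite inE/= in_itv/= => /andP[t1 t2]; rewrite mulr1 /ball_profile.
      have t3 : t ^+ 2 <= 4^-1 by nra.
      rewrite ifT; last by lra.
      rewrite lerXn2r ?nnegrE ?sqrtr_ge0//.
      rewrite -(@ler_pXn2r _ 2) ?nnegrE ?sqrtr_ge0// sqr_sqrtr; last by lra.
      by rewrite expr2; lra.
    by move=> _; rewrite mulr0 ball_profile_ge0.
have If : I \is a fin_num.
  by rewrite ge0_fin_numE ?(le_lt_trans leI) ?ltry//; apply: le_trans geI; rewrite lee_fin exprn_ge0.
rewrite /ball_factor -/I fineK//; split=> //.
by rewrite -lte_fin fineK// (lt_le_trans _ geI)// lte_fin exprn_gt0.
Qed.

End BallFactor.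

Definition ball_const (R : realType) n : R := \prod_(i < n) ball_factor R i.

Lemma ball_const_gt0 (R : realType) n : 0 < ball_const R n.
Proof. by apply: prodr_gt0 => i _; case: (@integral_ball_profile R i). Qed.

Lemma row_mx_scalar_sub (R : realType) n (t : R) (w : 'rV[R]_n) (c : 'rV[R]_(1 + n)) :
  row_mx (t%:M : 'rV[R]_1) w - c = row_mx (t - lsubmx c 0 0)%:M (w - rsubmx c).
Proof.
rewrite -[in LHS](hsubmxK c) opp_row_mx add_row_mx [lsubmx c in LHS]mx11_scalar.
by rewrite raddfB.
Qed.

(** Induction on n.  By [bform_slice] the slice at first coordinate t is an
    ellipsoid for the lower right block of q, of squared radius r - s (t - c0)^2
    with s the Schur complement.  An affine substitution turns the remaining
    integral over t into [ball_factor], and [det_schur] recombines the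
    determinants. *)
Lemma volume_ellipsoid (R : realType) n (q : 'M[R]_n) c r : posdef q ->
  volume [set v | bform q (v - c) (v - c) < r] =
  (ball_const R n * ball_profile n r / Num.sqrt (\det q))%:E.
Proof.
elim: n q c r => [|n IH] q c r qp /=.
  rewrite /ball_const big_ord0 det_mx00 sqrtr1 divr1 mul1r indicE.
  congr (_%:E); rewrite /ball_profile expr0.
  have E0 : bform q (0 - c) (0 - c) = 0 by rewrite /bform [_ - _]thinmx0 !mul0mx mxE.
  case: ifPn => r0; first by rewrite mem_set//= E0.
  by rewrite memNset//= E0; exact/negP.
pose q1 : 'M[R]_(1 + n) := q; pose c1 : 'rV[R]_(1 + n) := c.
have qp1 : posdef q1 by [].
pose s := schur q1; have s0 : 0 < s by exact: schur_gt0.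
have dQ0 : 0 < \det (drsubmx q1) by apply/posdef_det_gt0/posdef_drsubmx.
pose c0 := lsubmx c1 0 0.
have slice t : volume [set v : 'rV[R]_n |
     [set v | bform q (v - c) (v - c) < r] (row_mx (t%:M : 'rV[R]_1) v)] =
   (ball_const R n * ball_profile n (r - s * (t - c0) ^+ 2)
     / Num.sqrt (\det (drsubmx q1)))%:E.
  rewrite -(IH _ (rsubmx c1 - (t - c0) *: (ursubmx q1 *m invmx (drsubmx q1))));
    last exact: posdef_drsubmx.
  congr volume; apply/seteqP.
  suff E w : bform q (row_mx (t%:M : 'rV[R]_1) w - c) (row_mx (t%:M : 'rV[R]_1) w - c) =
     s * (t - c0) ^+ 2 + bform (drsubmx q1)
       (w - (rsubmx c1 - (t - c0) *: (ursubmx q1 *m invmx (drsubmx q1))))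
       (w - (rsubmx c1 - (t - c0) *: (ursubmx q1 *m invmx (drsubmx q1)))).
    by split => w /=; rewrite E ltrBrDl.
  have -> : (row_mx (t%:M : 'rV[R]_1) w - c : 'rV_(1 + n)) =
      row_mx (t - c0)%:M (w - rsubmx c1).
    exact: (row_mx_scalar_sub t w c1).
  rewrite [LHS](bform_slice qp1) -/s; congr (_ + _).
  by rewrite opprB addrA addrAC.
under eq_integral do rewrite slice.
have -> : \det q = s * \det (drsubmx q1) by exact: det_schur.
rewrite sqrtrM ?ltW//.
have [r0|r0] := ltP 0 r; last first.
  rewrite {2}/ball_profile ltNge r0/= mulr0 mul0r integral0_eq// => t _.
  rewrite /ball_profile ltNge (_ : _ <= 0) ?mulr0 ?mul0r//.
  by rewrite subr_le0 (le_trans r0)// mulr_ge0 ?sqr_ge0// ltW.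
(* The substitution for which r - s (t - c0)^2 = r (1 - (k (t - c0))^2). *)
pose k := Num.sqrt (s / r).
have k0 : 0 < k by rewrite sqrtr_gt0 divr_gt0.
have E t : ball_profile n (r - s * (t - c0) ^+ 2) =
    Num.sqrt r ^+ n * ball_profile n (1 - (k * (t - c0)) ^+ 2).
  rewrite -ball_profile_scale//; congr ball_profile.
  rewrite exprMn sqr_sqrtr; last by rewrite ltW ?divr_gt0.
  by field; rewrite gt_eqF.
pose K := ball_const R n * Num.sqrt r ^+ n / Num.sqrt (\det (drsubmx q1)).
have K0 : 0 <= K.
  by rewrite !mulr_ge0 ?invr_ge0 ?exprn_ge0 ?sqrtr_ge0// ltW// ball_const_gt0.
under eq_integral => t _.
  rewrite E (_ : _ / _ = K * ball_profile n (1 - (k * (t - c0)) ^+ 2)); last first.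
    by rewrite /K; ring.
  rewrite EFinM; over.
pose B t : R := ball_profile n (1 - t ^+ 2).
have mB : measurable_fun setT B by exact: measurable_ball_profile.
rewrite ge0_integralZl_EFin//; last 2 first.
- by move=> t _; rewrite lee_fin ball_profile_ge0.
- apply/measurable_EFinP; apply: (measurableT_comp mB).
  apply: continuous_measurable_fun => t; apply: cvgM; first exact: cvg_cst.
  by apply: cvgB => //; exact: cvg_cst.
rewrite (@lebesgue_integral_affine _ B)//; last by move=> t; exact: ball_profile_ge0.
have [-> _] := @integral_ball_profile R n.
rewrite -!EFinM; congr (_%:E).
rewrite /ball_const big_ord_recr/= -/(ball_const R n) /ball_profile r0.
rewrite /K /k sqrtrM ?ltW// sqrtrV ?ltW// exprSr; field.
by rewrite !gt_eqF ?sqrtr_gt0.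
Qed.

(** * The unit ball of a Randers norm *)

Section RandersBall.
Context {R : realType} {n : nat}.
Implicit Types (h : 'M[R]_n) (v w X : 'rV[R]_n).

Lemma bform_ge0 h v : posdef h -> 0 <= bform h v v.
Proof.
move=> [_ hp]; have [->|v0] := eqVneq v 0; first by rewrite bform0l.
exact/ltW/hp.
Qed.

Lemma bform_cauchy h v w : posdef h ->
  bform h v w ^+ 2 <= bform h v v * bform h w w.
Proof.
move=> hp; have [->|v0] := eqVneq v 0; first by rewrite !bform0l expr0n mul0r.
have vv := hp.2 _ v0.
have := bform_ge0 (bform h v v *: w - bform h v w *: v) hp.
rewrite bformDl !bformDr !(bformNl, bformNr) !(bformZl, bformZr) (bformC w v hp.1).
set a := bform h v v; set b := bform h v w; set c := bform h w w => H.
have {H} : 0 <= a * (a * c - b ^+ 2) by apply: le_trans H _; rewrite le_eqVlt; apply/orP; left; apply/eqP; ring.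
by rewrite pmulr_rge0// subr_ge0.
Qed.

(** The quadratic form alpha^2 - beta^2 for beta = h(X, .). *)
Definition randers_quad h X : 'M[R]_n := h - (X *m h)^T *m (X *m h).

Lemma bform_randers_quad h X v w : bform (randers_quad h X) v w =
  bform h v w - bform h X v * bform h X w.
Proof.
rewrite /bform /randers_quad mulmxBr mulmxBl mxE; congr (_ + _).
rewrite mxE; congr (- _).
have -> : v *m ((X *m h)^T *m (X *m h)) *m w^T = (v *m (X *m h)^T) *m (X *m h *m w^T).
  by rewrite !mulmxA.
rewrite mxE big_ord1; congr (_ * _).
by rewrite -[RHS](mxE trmx_key (fun i j => _ j i)) -/(trmx _) [in RHS]trmx_mul trmxK.
Qed.

Lemma posdef_randers_quad h X : posdef h -> bform h X X < 1 ->
  posdef (randers_quad h X).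
Proof.
move=> hp B1; split.
  by rewrite /randers_quad linearB/= trmx_mul trmxK hp.1.
move=> v v0; rewrite bform_randers_quad subr_gt0 -expr2.
apply: le_lt_trans (bform_cauchy X v hp) _.
by rewrite gtr_pMl// hp.2.
Qed.

(** Both sides are the determinant of the bordered matrix with first row (1, X h)
    and first column (1, X h)^T: eliminate with the first row, or with the
    others. *)
Lemma det_randers_quad h X : h^T = h -> \det (randers_quad h X) = (1 - bform h X X) * \det h.
Proof.
move=> hT; pose Z := block_mx (1%:M : 'M[R]_1) (X *m h) (X *m h)^T h.
transitivity (\det Z).
  pose L := block_mx (1%:M : 'M[R]_1) 0 (- (X *m h)^T) (1%:M : 'M[R]_n).
  have dL : \det L = 1 by rewrite det_lblock !det1 mulr1.
  rewrite -[RHS]mul1r -dL -det_mulmx mulmx_block !mul1mx !mul0mx !addr0 mulmx1.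
  by rewrite addNr mulNmx addrC det_ublock det1 mul1r.
pose U := block_mx (1%:M : 'M[R]_1) (- X) 0 (1%:M : 'M[R]_n).
have dU : \det U = 1 by rewrite det_ublock !det1 mulr1.
rewrite -[LHS]mul1r -[X in X * _ = _]dU -det_mulmx mulmx_block !mul1mx !mul0mx !add0r !mulNmx subrr.
rewrite det_lblock; congr (_ * _).
by rewrite [X in \det X]mx11_scalar det_scalar1 mxE [in X in _ + X]mxE mxE eqxx trmx_mul hT mulmxA.
Qed.

(** For beta < 1, square alpha < 1 - beta and complete the square.  For beta >= 1
    both sides are false, since beta^2 <= B alpha^2. *)
Lemma randers_ballE h X v : posdef h -> bform h X X < 1 ->
  let B := bform h X X in let c := - (1 - B)^-1 *: X in
  (Num.sqrt (bform h v v) + bform h X v < 1) =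
  (bform (randers_quad h X) (v - c) (v - c) < (1 - B)^-1).
Proof.
move=> hp B1 /=; have := bform_cauchy X v hp.
have := bform_ge0 X hp; have := bform_ge0 v hp; move: B1.
rewrite bform_randers_quad scaleNr opprK.
rewrite !(bformDl, bformDr) !(bformZl, bformZr) (bformC v X hp.1).
set B := bform h X X; set a := bform h v v; set b := bform h X v => B1 a0 B0 ab.
have B10 : 1 - B != 0 by rewrite gt_eqF// subr_gt0.
rewrite (_ : _ - _ = a - b ^+ 2 + 2 * b + B / (1 - B)); last by field.
rewrite [X in _ = (_ < X)](_ : _ = 1 + B / (1 - B)); last by field.
rewrite ltrD2r -ltrBrDr; have [b1|b1] := ltP b 1.
  rewrite -[RHS]subr_gt0 -[LHS](@ltr_pXn2r _ 2) ?nnegrE ?sqrtr_ge0 ?subr_ge0 ?ltW//.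
  by rewrite sqr_sqrtr// -subr_gt0; congr (0 < _); ring.
transitivity false; first by apply/negbTE; rewrite -leNgt (le_trans _ (sqrtr_ge0 _))// subr_le0.
symmetry; apply/negbTE; rewrite -leNgt; nra.
Qed.

(** The inverse of this volume is, up to a constant, the Busemann-Hausdorff density
    (1 - |X|^2)^((n + 1) / 2) sqrt (det h) of the Randers metric. *)
Lemma volume_randers_ball h X : posdef h -> bform h X X < 1 ->
  volume [set v | Num.sqrt (bform h v v) + bform h X v < 1] =
  (ball_const R n / (Num.sqrt (\det h) * Num.sqrt (1 - bform h X X) ^+ n.+1))%:E.
Proof.
move=> hp B1; have B10 : 0 < 1 - bform h X X by rewrite subr_gt0.
rewrite (_ : [set _ | _] = [set v | bform (randers_quad h X)
    (v - (- (1 - bform h X X)^-1 *: X)) (v - (- (1 - bform h X X)^-1 *: X))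
    < (1 - bform h X X)^-1]); last first.
  by apply/seteqP; split => v /=; rewrite randers_ballE.
rewrite volume_ellipsoid; last exact: posdef_randers_quad.
congr (_%:E); rewrite det_randers_quad; last exact: hp.1.
rewrite /ball_profile invr_gt0 B10 sqrtrM ?ltW// sqrtrV ?ltW// exprS exprVn.
have dh := posdef_det_gt0 hp.
field; rewrite !gt_eqF ?exprn_gt0 ?sqrtr_gt0//.
Qed.
End RandersBall.

(** * Directional derivatives *)

Section DeriveTools.
Context {R : realType} {V : normedModType R}.
Implicit Types (x v : V).

(** The sum and product rules for functions written pointwise, the form in which
    explicit formulas present themselves to unification. *)
Lemma is_derive_fun_add (W : normedModType R) (f g : V -> W) x v (df dg : W) :
  is_derive x v f df -> is_derive x v g dg ->
  is_derive x v (fun z => f z + g z) (df + dg).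
Proof. exact: is_deriveD. Qed.

Lemma is_derive_fun_sub (W : normedModType R) (f g : V -> W) x v (df dg : W) :
  is_derive x v f df -> is_derive x v g dg ->
  is_derive x v (fun z => f z - g z) (df - dg).
Proof. exact: is_deriveB. Qed.

Lemma is_derive_fun_mul (f g : V -> R) x v (df dg : R) :
  is_derive x v f df -> is_derive x v g dg ->
  is_derive x v (fun z => f z * g z) (df * g x + f x * dg).
Proof.
move=> Df Dg; apply: (is_derive_eq (is_deriveM Df Dg)).
by rewrite addrC -[f x *: _]/(f x * _) -[g x *: _]/(g x * _) (mulrC (g x)).
Qed.

Lemma is_derive_const (W : normedModType R) (c : W) x v : is_derive x v (fun=> c) 0.
Proof. exact: is_derive_cst. Qed.

Lemma is_derive_fun_scale (f : V -> R) (k : R) x v (df : R) :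
  is_derive x v f df -> is_derive x v (fun z => k * f z) (k * df).
Proof.
move=> Df; apply: (is_derive_eq (is_derive_fun_mul (is_derive_const k x v) Df)).
by rewrite mul0r add0r.
Qed.

Lemma is_derive_fun_sum (W : normedModType R) (I : Type) (r : seq I)
    (f : I -> V -> W) x v (df : I -> W) :
  (forall i, is_derive x v (f i) (df i)) ->
  is_derive x v (fun z => \sum_(i <- r) f i z) (\sum_(i <- r) df i).
Proof.
move=> Df; elim: r => [|i r IH].
  by under eq_fun do rewrite big_nil; rewrite big_nil; exact: is_derive_const.
by under eq_fun do rewrite big_cons; rewrite big_cons; exact: is_derive_fun_add.
Qed.

(** Transports one-variable results, such as the chain rule and the mean value
    theorem, to directional derivatives. *)
Lemma is_derive_lineP (W : normedModType R) (f : V -> W) x v (df : W) :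
  is_derive x v f df <-> is_derive (0 : R) 1 (fun t : R => f (t *: v + x)) df.
Proof.
have E : 'D_v f x = 'D_1 (fun t : R => f (t *: v + x)) 0.
  rewrite /derive; set g1 := fun h => h^-1 *: _; set g2 := fun h => h^-1 *: _.
  suff -> : g1 = g2 by [].
  by apply/funext => t; rewrite /g1 /g2/= addr0 scale0r add0r [_%:A]mulr1.
split=> -[H1 H2]; split.
- exact: (derivable1P f x v).1.
- by rewrite -E.
- exact: (derivable1P f x v).2.
- by rewrite E.
Qed.

Lemma is_derive_comp1 (f : V -> R) (phi : R -> R) x v (df dphi : R) :
  is_derive (f x) 1 phi dphi -> is_derive x v f df ->
  is_derive x v (fun z => phi (f z)) (dphi * df).
Proof.
move=> Dphi /is_derive_lineP Df; apply/is_derive_lineP.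
by apply: (@is_derive1_comp _ phi (fun t => f (t *: v + x))) => //; rewrite scale0r add0r.
Qed.

Lemma is_derive_mxP m n (M : V -> 'M[R]_(m, n)) x v (dM : 'M[R]_(m, n)) :
  is_derive x v M dM <-> forall i j, is_derive x v (fun z => M z i j) (dM i j).
Proof.
split=> [[H1 <-] i j|H].
  by split; [exact: (derivable_mxP M x v).1|rewrite derive_mx// mxE].
have H1 : derivable M x v by apply/derivable_mxP => i j; case: (H i j).
split=> //; rewrite derive_mx//; apply/matrixP => i j; rewrite mxE.
by case: (H i j).
Qed.

Lemma is_derive_mulmx m n p (A : V -> 'M[R]_(m, n)) (B : V -> 'M[R]_(n, p)) x v dA dB :
  is_derive x v A dA -> is_derive x v B dB ->
  is_derive x v (fun z => A z *m B z) (dA *m B x + A x *m dB).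
Proof.
move=> /is_derive_mxP DA /is_derive_mxP DB; apply/is_derive_mxP => i j.
under eq_fun do rewrite mxE.
rewrite !mxE -big_split/=; apply: is_derive_fun_sum => k.
exact: is_derive_fun_mul.
Qed.

Lemma is_derive_trmx m n (A : V -> 'M[R]_(m, n)) x v dA :
  is_derive x v A dA -> is_derive x v (fun z => (A z)^T) dA^T.
Proof.
move=> /is_derive_mxP DA; apply/is_derive_mxP => i j.
by under eq_fun do rewrite mxE; rewrite mxE.
Qed.

Lemma is_derive_prod (I : eqType) (r : seq I) (f : I -> V -> R) x v (df : I -> R) :
  uniq r -> (forall i, is_derive x v (f i) (df i)) ->
  is_derive x v (fun z => \prod_(i <- r) f i z)
    (\sum_(k <- r) \prod_(i <- r) (if i == k then df k else f i x)).
Proof.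
move=> ur Df; elim: r ur => [_|k r IH /= /andP[kr ur]].
  by under eq_fun do rewrite big_nil; rewrite big_nil; exact: is_derive_const.
under eq_fun do rewrite big_cons.
apply: (is_derive_eq (is_derive_fun_mul (Df k) (IH ur))).
rewrite big_cons big_cons eqxx; congr (_ * _ + _).
  rewrite [LHS]big_seq [RHS]big_seq; apply: eq_bigr => i ir.
  by case: eqP => // ik; rewrite -ik ir in kr.
rewrite mulr_sumr [LHS]big_seq [RHS]big_seq; apply: eq_bigr => i ir.
by rewrite big_cons; case: eqP => // ik; rewrite ik ir in kr.
Qed.

(** Jacobi's formula.  The product rule in the Leibniz expansion gives the sum over
    k of the determinants in which row k is replaced by its derivative; expand
    each one along that row. *)
Lemma is_derive_det n (A : V -> 'M[R]_n) x v dA :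
  is_derive x v A dA ->
  is_derive x v (fun z => \det (A z)) (\tr (dA *m \adj (A x))).
Proof.
move=> /is_derive_mxP DA.
pose B k : 'M[R]_n := \matrix_(i, j) (if i == k then dA k j else A x i j).
have -> : \tr (dA *m \adj (A x)) = \sum_k \det (B k).
  rewrite /mxtrace; apply: eq_bigr => k _; rewrite (expand_det_row _ k) mxE.
  apply: eq_bigr => j _; rewrite [B k k j]mxE eqxx [\adj _ _ _]mxE; congr (_ * _).
  rewrite /cofactor; congr (_ * \det _); apply/matrixP => i l; rewrite !mxE.
  by rewrite eq_sym (negbTE (neq_lift _ _)).
have -> : \sum_k \det (B k) = \sum_(s : 'S_n) (-1) ^+ s *
    \sum_k \prod_i (if i == k then dA k (s k) else A x i (s i)).
  rewrite exchange_big/=; apply: eq_bigr => s _; rewrite mulr_sumr.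
  apply: eq_bigr => k _; congr (_ * _); apply: eq_bigr => i _; rewrite mxE.
  by case: eqP => // ->.
rewrite /determinant.
apply: is_derive_fun_sum => s; apply: is_derive_fun_scale.
exact: is_derive_prod (index_enum_uniq _) _.
Qed.

End DeriveTools.

Section DeriveDirection.
Context {R : realType} {V : normedModType R}.
Implicit Types (x v : V).

Lemma is_derive_dirZ (f : V -> R) x v (k df : R) :
  is_derive x v f df -> is_derive x (k *: v) f (k * df).
Proof.
move=> /is_derive_lineP Df; apply/is_derive_lineP.
have -> : (fun t : R => f (t *: (k *: v) + x)) =
    (fun s : R => f (s *: v + x)) \o (fun t : R => k * t).
  by apply/funext => t /=; rewrite scalerA (mulrC k).
rewrite mulrC; apply: is_derive1_comp; first by rewrite mulr0.
rewrite -[X in is_derive _ _ _ X]mulr1.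
exact: is_derive_fun_scale (is_derive_id _ _).
Qed.

Lemma is_derive_line_at (f : V -> R) x v (s : R) :
  derivable f (s *: v + x) v ->
  is_derive s 1 (fun r : R => f (r *: v + x)) ('D_v f (s *: v + x)).
Proof.
move=> /derivableP/is_derive_lineP Df.
have -> : (fun r : R => f (r *: v + x)) =
    (fun r : R => f (r *: v + (s *: v + x))) \o (fun r : R => r - s).
  by apply/funext => r /=; rewrite addrA -scalerDl subrK.
rewrite -[X in is_derive _ _ _ X]mulr1; apply: is_derive1_comp; first by rewrite subrr.
rewrite -[X in is_derive _ _ _ X]subr0.
exact: is_derive_fun_sub (is_derive_id _ _) (is_derive_const _ _ _).
Qed.

(** Go from x to x + t u + t v through x + t u.  By the mean value theorem the
    second increment is t times a value of 'D_v f at a point close to x, and 'D_v f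
    is continuous at x. *)
Lemma is_derive_dirD (f : V -> R) x u v :
  derivable f x u -> (\forall z \near x, derivable f z v) ->
  {for x, continuous ('D_v f)} ->
  is_derive x (u + v) f ('D_u f x + 'D_v f x).
Proof.
move=> Du nDv cDv.
suff H : (fun t : R => t^-1 *: (f (t *: (u + v) + x) - f x)) @ 0^' --> 'D_u f x + 'D_v f x.
  by split; [apply/cvg_ex; eexists; exact: H|exact/cvg_lim].
have -> : (fun t : R => t^-1 *: (f (t *: (u + v) + x) - f x)) =
    (fun t => t^-1 *: (f (t *: u + x) - f x)) +
    (fun t => t^-1 *: (f (t *: v + (t *: u + x)) - f (t *: u + x))).
  apply/funext => t; rewrite fctE -scalerDr; congr (_ *: _).
  by rewrite scalerDr (addrC (t *: u)) -addrA [RHS]addrC subrKA.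
apply: cvgD; first exact: Du.
apply/cvgrPdist_lt => eps eps0.
have : \forall z \near x, derivable f z v /\ `|'D_v f x - 'D_v f z| < eps.
  by apply: filterI => //; move/cvgrPdist_lt: cDv => /(_ _ eps0).
move=> /nbhs_ballP[d /= d0 dP].
(* A bound for the displacement: |s v + t u| <= |t| K whenever |s| <= |t|. *)
pose K := `|u| + `|v| + 1.
have K0 : 0 < K by rewrite /K; have := normr_ge0 u; have := normr_ge0 v; lra.
near=> t.
have t0 : t != 0 by near: t; exact: nbhs_dnbhs_neq.
have td : `|t| < d / K by near: t; apply: dnbhs0_lt; rewrite divr_gt0.
have inball (s : R) : `|s| <= `|t| -> ball x d (s *: v + (t *: u + x)).
  move=> st; rewrite -ball_normE /ball_/= addrA opprD addrCA subrr addr0 normrN.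
  apply: (@le_lt_trans _ _ (`|t| * K)); last by rewrite -ltr_pdivlMr.
  apply: (le_trans (ler_normD _ _)); rewrite !normrZ /K !mulrDr mulr1.
  have := ler_wpM2r (normr_ge0 v) st; have := normr_ge0 t; lra.
pose phi (s : R) := f (s *: v + (t *: u + x)).
have Dphi (s : R) : `|s| <= `|t| -> is_derive s 1 phi ('D_v f (s *: v + (t *: u + x))).
  by move=> st; apply: is_derive_line_at; case: (dP _ (inball s st)).
have [s st Es] : exists2 s, `|s| <= `|t| &
    phi t - phi 0 = 'D_v f (s *: v + (t *: u + x)) * t.
  have cphi a b : (forall s, s \in `[a, b] -> `|s| <= `|t|) ->
      {within `[a, b], continuous phi}.
    move=> ab; apply: derivable_within_continuous => s sab.
    by have [] := Dphi s (ab s sab).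
  have [t0'|t0'] := leP 0 t.
    have bd s : s \in `[0, t] -> `|s| <= `|t|.
      by rewrite in_itv/= => /andP[s0 s1]; rewrite !ger0_norm.
    have [||s sI ->] := @MVT_segment R phi (fun s => 'D_v f (s *: v + (t *: u + x))) 0 t t0'.
    - by move=> s sI; apply/Dphi/bd/subset_itv_oo_cc.
    - exact: cphi.
    - by exists s; [exact: bd|rewrite subr0].
  have bd s : s \in `[t, 0] -> `|s| <= `|t|.
    rewrite in_itv/= => /andP[s0 s1]; rewrite ler0_norm// ler0_norm ?lerN2// ltW//.
  have [||s sI E] := @MVT_segment R phi (fun s => 'D_v f (s *: v + (t *: u + x))) t 0 (ltW t0').
  - by move=> s sI; apply/Dphi/bd/subset_itv_oo_cc.
  - exact: cphi.
  - by exists s; [exact: bd|rewrite -opprB E sub0r mulrN opprK].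
have -> : t^-1 *: (f (t *: v + (t *: u + x)) - f (t *: u + x)) =
    'D_v f (s *: v + (t *: u + x)).
  move: Es; rewrite /phi scale0r add0r => ->.
  by rewrite -[t^-1 *: _]/(t^-1 * _) mulrC mulfK.
by have [_] := dP _ (inball s st).
Unshelve. all: by end_near. Qed.

Lemma is_derive_dir_sum (I : Type) (r : seq I) (w : I -> V) (f : V -> R) x :
  (forall v, (\forall z \near x, derivable f z v) /\ {for x, continuous ('D_v f)}) ->
  is_derive x (\sum_(i <- r) w i) f (\sum_(i <- r) 'D_(w i) f x).
Proof.
move=> C1; elim: r => [|i r IH]; first by rewrite !big_nil; exact: is_derive0.
rewrite !big_cons addrC [X in is_derive _ _ _ X]addrC.
have [_ <-] := IH.
apply: is_derive_dirD; last by case: (C1 (w i)).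
  by case: IH.
by case: (C1 (w i)).
Qed.

End DeriveDirection.

(** For a C^1 map the derivative is linear in the direction, hence given by the
    partial derivatives.  This is what relates brackets of vector fields to the
    partial derivatives that occur in the spray. *)
Lemma C1_is_derive (R : realType) n p q (U : set 'rV[R]_n)
    (f : 'rV[R]_n -> 'M[R]_(p, q)) x v :
  open U -> U x -> Ck_on 1 U f ->
  is_derive x v f (\sum_i v 0 i *: 'D_(delta_mx 0 i) f x).
Proof.
move=> oU Ux [_ C1]; have nU : \forall z \near x, U z by exact: open_nbhs_nbhs.
apply/is_derive_mxP => a b; rewrite summxE.
have Dfab u z : U z -> is_derive z u (fun y => f y a b) ('D_u f z a b).
  move=> Uz; apply: (is_derive_mxP f z u _).1.
  by apply: derivableP; have [] := C1 u => H _; exact: H.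
have E u : 'D_u f x a b = 'D_u (fun y => f y a b) x by case: (Dfab u x Ux).
under eq_bigr do rewrite mxE E.
have C1ab u : (\forall z \near x, derivable (fun y => f y a b) z u) /\
    {for x, continuous ('D_u (fun y => f y a b))}.
  split; first by apply: filterS nU => z Uz; case: (Dfab u z Uz).
  have : {for x, continuous (fun z => 'D_u f z a b)}.
    have [_ [cD _]] := C1 u.
    apply: (@continuous_comp _ _ _ ('D_u f) (fun M : 'M[R]_(p, q) => M a b)); first exact: cD.
    exact: coord_continuous.
  have ee : \forall z \near x, 'D_u f z a b = 'D_u (fun y => f y a b) z.
    by apply: filterS nU => z Uz; case: (Dfab u z Uz).
  move=> cc; rewrite /prop_for/= /continuous_at -E.
  exact: cvg_trans (near_eq_cvg ee) cc.
rewrite [X in is_derive _ X](row_sum_delta v).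
have := is_derive_dir_sum (index_enum 'I_n) (fun i => v 0 i *: delta_mx 0 i) C1ab.
move=> H; apply: is_derive_eq H _; apply: eq_bigr => i _.
by case: (is_derive_dirZ (v 0 i) (derivableP (nbhs_singleton (C1ab (delta_mx 0 i)).1))).
Qed.

(** * The fundamental tensor of a Randers norm *)

Definition lform (R : realType) n (b v : 'rV[R]_n) : R := (b *m v^T) 0 0.

Definition rnorm (R : realType) n (h : 'M[R]_n) (v : 'rV[R]_n) : R := Num.sqrt (bform h v v).

(** Here and below the 1-form beta is the row b of its coefficients. *)
Definition randers_norm (R : realType) n (h : 'M[R]_n) (b v : 'rV[R]_n) : R := rnorm h v + lform b v.

(** The derivative of the Randers norm at u in the direction w. *)
Definition randers_norm_dy (R : realType) n (h : 'M[R]_n) (b u w : 'rV[R]_n) : R :=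
  bform h u w / rnorm h u + lform b w.

Section Lform.
Context {R : realType} {n : nat}.
Implicit Types (b v w : 'rV[R]_n).

Lemma lformDr b v w : lform b (v + w) = lform b v + lform b w.
Proof. by rewrite /lform linearD/= mulmxDr mxE. Qed.

Lemma lformZr b k v : lform b (k *: v) = k * lform b v.
Proof. by rewrite /lform linearZ/= -scalemxAr mxE. Qed.

Lemma lform_delta b i : lform b (delta_mx 0 i) = b 0 i.
Proof. by rewrite /lform trmx_delta -colE mxE. Qed.

Lemma lformE b v : lform b v = \sum_i v 0 i * b 0 i.
Proof. by rewrite /lform mxE; apply: eq_bigr => i _; rewrite mxE mulrC. Qed.

Lemma bform_lform (h : 'M[R]_n) v w : bform h v w = lform (v *m h) w.
Proof. by []. Qed.

Lemma bform_delta (h : 'M[R]_n) i j : bform h (delta_mx 0 i) (delta_mx 0 j) = h i j.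
Proof. by rewrite bform_lform lform_delta -rowE mxE. Qed.

End Lform.

Section FibreDerivatives.
Context {R : realType} {n : nat}.
Implicit Types (h : 'M[R]_n) (b u v w y z : 'rV[R]_n).

Lemma is_derive_bform (W : normedModType R) (q : W -> 'M[R]_n) (v w : W -> 'rV[R]_n)
    (x s : W) dq dv dw :
  is_derive x s q dq -> is_derive x s v dv -> is_derive x s w dw ->
  is_derive x s (fun z : W => bform (q z) (v z) (w z))
    (bform dq (v x) (w x) + bform (q x) dv (w x) + bform (q x) (v x) dw).
Proof.
move=> Dq Dv Dw.
have /is_derive_mxP/(_ 0 0) D :=
  is_derive_mulmx (is_derive_mulmx Dv Dq) (is_derive_trmx Dw).
apply: (is_derive_eq D).
by rewrite /bform mulmxDl [LHS]mxE [X in X + _ = _]mxE [X in X + _ = _]addrC.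
Qed.

Lemma is_derive_lform (W : normedModType R) (b w : W -> 'rV[R]_n) (x s : W) db dw :
  is_derive x s b db -> is_derive x s w dw ->
  is_derive x s (fun z : W => lform (b z) (w z)) (lform db (w x) + lform (b x) dw).
Proof.
move=> Db Dw.
have /is_derive_mxP/(_ 0 0) D := is_derive_mulmx Db (is_derive_trmx Dw).
by apply: (is_derive_eq D); rewrite mxE.
Qed.

Lemma rnorm_gt0 h v : posdef h -> v != 0 -> 0 < rnorm h v.
Proof. by move=> hp v0; rewrite sqrtr_gt0 hp.2. Qed.

Lemma sqr_rnorm h v : posdef h -> rnorm h v ^+ 2 = bform h v v.
Proof. by move=> hp; rewrite sqr_sqrtr// bform_ge0. Qed.

Lemma is_derive_rnorm h u w : posdef h -> u != 0 ->
  is_derive u w (rnorm h) (bform h u w / rnorm h u).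
Proof.
move=> hp u0.
have D := is_derive_comp1 (f := fun v => bform h v v) (is_derive1_sqrt (hp.2 _ u0))
  (is_derive_bform (is_derive_const h u w) (is_derive_id u w) (is_derive_id u w)).
apply: (is_derive_eq D).
rewrite [bform 0 u u]/bform mulmx0 mul0mx mxE add0r (bformC w u hp.1) -/(rnorm h u).
have := rnorm_gt0 hp u0 => a0.
by field; rewrite gt_eqF.
Qed.

Lemma is_derive_randers_norm h b u w : posdef h -> u != 0 ->
  is_derive u w (randers_norm h b) (randers_norm_dy h b u w).
Proof.
move=> hp u0; apply: is_derive_fun_add; first exact: is_derive_rnorm.
have D := is_derive_lform (is_derive_const b u w) (is_derive_id u w).
by apply: (is_derive_eq D); rewrite /lform mul0mx mxE add0r.
Qed.

Lemma is_derive_bform_div h u w z : posdef h -> u != 0 ->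
  is_derive u z (fun u => bform h u w / rnorm h u)
    (bform h z w / rnorm h u - bform h u w * bform h u z / rnorm h u ^+ 3).
Proof.
move=> hp u0; have a0 := rnorm_gt0 hp u0.
have D1 := is_derive_bform (is_derive_const h u z) (is_derive_id u z) (is_derive_const w u z).
have D2 := is_derive_comp1 (f := rnorm h) (phi := fun t => t^-1)
  (is_deriveV (f := id) (lt0r_neq0 a0) (is_derive_id (rnorm h u) 1)) (is_derive_rnorm z hp u0).
apply: (is_derive_eq (is_derive_fun_mul D1 D2)).
rewrite [bform 0 u w]/bform mulmx0 mul0mx mxE bform0r add0r addr0 -[_ *: _]/(_ * _).
by field; rewrite gt_eqF.
Qed.

Lemma is_derive_randers_norm_dy h b u w z : posdef h -> u != 0 ->
  is_derive u z (fun u => randers_norm_dy h b u w)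
    (bform h z w / rnorm h u - bform h u w * bform h u z / rnorm h u ^+ 3).
Proof.
move=> hp u0.
have D := is_derive_fun_add (is_derive_bform_div w z hp u0) (is_derive_const (lform b w) u z).
by apply: (is_derive_eq D); rewrite addr0.
Qed.

Lemma near_neq0 y : y != 0 -> \forall u \near y, u != 0.
Proof. move=> y0; have := @cvgr_neq0 R 'rV[R]_n _ (nbhs y) _ id y; exact. Qed.

(** The value of the fundamental tensor, see [fundamental_tensor_randers]. *)
Definition randers_metric h b y : 'M[R]_n :=
  (randers_norm h b y / rnorm h y) *: h
  - (randers_norm h b y / rnorm h y ^+ 3) *: ((y *m h)^T *m (y *m h))
  + ((rnorm h y)^-1 *: (y *m h) + b)^T *m ((rnorm h y)^-1 *: (y *m h) + b).

Lemma bform_outer b v u w : bform (b^T *m v) u w = lform b u * lform v w.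
Proof.
rewrite /bform /lform.
have -> : u *m (b^T *m v) *m w^T = (u *m b^T) *m (v *m w^T) by rewrite !mulmxA.
rewrite mxE big_ord1; congr (_ * _).
by rewrite -[RHS](mxE trmx_key (fun i j => _ j i)) -/(trmx _) [in RHS]trmx_mul trmxK.
Qed.

Lemma bform_randers_metric h b y u w : bform (randers_metric h b y) u w =
  randers_norm h b y * (bform h u w / rnorm h y - bform h y u * bform h y w / rnorm h y ^+ 3)
  + randers_norm_dy h b y u * randers_norm_dy h b y w.
Proof.
have dE z : lform ((rnorm h y)^-1 *: (y *m h) + b) z = randers_norm_dy h b y z.
  by rewrite /lform mulmxDl -scalemxAl mxE [in X in X + _]mxE mulrC.
have add_bform (p q : 'M[R]_n) : bform (p + q) u w = bform p u w + bform q u w.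
  by rewrite /bform mulmxDr mulmxDl mxE.
have scale_bform k (p : 'M[R]_n) : bform (k *: p) u w = k * bform p u w.
  by rewrite /bform -scalemxAr -scalemxAl mxE.
rewrite /randers_metric -scaleNr !add_bform !scale_bform !bform_outer !dE -!bform_lform.
by rewrite mulrBr; congr (_ + _ + _); rewrite 1?mulNr; [|congr (- _)]; ring.
Qed.

End FibreDerivatives.

Lemma fundamental_tensor_randers (R : realType) n (h : 'rV[R]_n -> 'M[R]_n)
    (b : 'rV[R]_n -> 'rV[R]_n) x y : posdef (h x) -> y != 0 ->
  fundamental_tensor (fun u v => randers_norm (h u) (b u) v) x y = randers_metric (h x) (b x) y.
Proof.
move=> hp y0; apply/matrixP => i j; rewrite mxE.
rewrite -[RHS]bform_delta bform_randers_metric.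
set F := randers_norm (h x) (b x); set ei := delta_mx 0 i; set ej := delta_mx 0 j.
have D1 u : u != 0 ->
    'D_ej (fun v => F v ^+ 2) u = 2 * (F u * randers_norm_dy (h x) (b x) u ej).
  move=> u0; have D := is_derive_randers_norm (b x) ej hp u0.
  have [_ ->] := is_derive_fun_mul D D.
  by rewrite -/F; ring.
have -> : 'D_ei (fun u => 'D_ej (fun v => F v ^+ 2) u) y =
    'D_ei (fun u => 2 * (F u * randers_norm_dy (h x) (b x) u ej)) y.
  by apply: near_eq_derive; apply: filterS (near_neq0 y0) => u; exact: D1.
have [_ ->] := is_derive_fun_scale 2 (is_derive_fun_mul (is_derive_randers_norm (b x) ei hp y0)
  (is_derive_randers_norm_dy (b x) ej ei hp y0)).
rewrite -/F.
have a0 : rnorm (h x) y != 0 by rewrite gt_eqF// rnorm_gt0.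
by field.
Qed.

(** Pairing a kernel vector u with y gives F dF(u) = 0, so dF(u) = 0.  What is left
    of the fundamental tensor is proportional to the h-orthogonal projection away
    from y, so u is a multiple k y of y, and dF(u) = k F(y) forces k = 0. *)
Lemma randers_metric_unit (R : realType) n (h : 'M[R]_n) (b y : 'rV[R]_n) :
  posdef h -> y != 0 -> randers_norm h b y != 0 -> randers_metric h b y \in unitmx.
Proof.
move=> hp y0 F0.
have a0 : rnorm h y != 0 by rewrite gt_eqF// rnorm_gt0.
have dy : randers_norm_dy h b y y = randers_norm h b y.
  by rewrite /randers_norm_dy /randers_norm -sqr_rnorm// expr2 mulfK.
rewrite -row_free_unit -kermx_eq0; apply/eqP/row_matrixP => i; rewrite row0.
set u := row i _.
have ug z : bform (randers_metric h b y) u z = 0.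
  by rewrite /bform; have /sub_kermxP -> := row_sub i (kermx (randers_metric h b y)); rewrite mul0mx mxE.
have du : randers_norm_dy h b y u = 0.
  have := ug y; rewrite bform_randers_metric dy -(sqr_rnorm y hp) (bformC u y hp.1).
  rewrite (_ : _ - _ = 0) ?mulr0 ?add0r; last by field.
  by move/eqP; rewrite mulf_eq0 (negbTE F0) orbF => /eqP.
have uy : u = (bform h y u / rnorm h y ^+ 2) *: y.
  apply/eqP; rewrite -subr_eq0; apply: contraT => /(hp.2).
  set z := _ - _ => zz.
  have := ug z; rewrite bform_randers_metric du mul0r addr0 => /eqP.
  rewrite mulf_eq0 (negbTE F0)/= => /eqP E.
  move: zz; rewrite {1}/z bformDl bformNl bformZl.
  rewrite (_ : _ - _ = rnorm h y * (bform h u z / rnorm h y -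
     bform h y u * bform h y z / rnorm h y ^+ 3)); last by field.
  by rewrite E mulr0 ltxx.
move: du; rewrite uy; set k := _ / _.
have -> : randers_norm_dy h b y (k *: y) = k * randers_norm_dy h b y y.
  by rewrite /randers_norm_dy bformZr lformZr; ring.
by rewrite dy => /eqP; rewrite mulf_eq0 (negbTE F0) orbF => /eqP ->; rewrite scale0r.
Qed.

(** * The spray of a Randers metric with closed 1-form *)

(** [dh m] and [db m] are the partial derivatives at x of the metric h and of the
    1-form b. *)
Section Spray.
Context {R : realType} {n : nat}.
Local Notation V := 'rV[R]_n.
Local Notation "''e_' i" := (delta_mx 0 i : V) (at level 8, i at level 2).
Variables (h : V -> 'M[R]_n) (b : V -> V) (x : V).
Variables (dh : 'I_n -> 'M[R]_n) (db : 'I_n -> V).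
Hypothesis hp : posdef (h x).
Hypothesis F_gt0 : forall v, v != 0 -> 0 < randers_norm (h x) (b x) v.
Hypothesis Dh : forall m, is_derive x 'e_m h (dh m).
Hypothesis Db : forall m, is_derive x 'e_m b (db m).
Hypothesis dhT : forall m, (dh m)^T = dh m.
Hypothesis closed : forall i j, db i 0 j = db j 0 i.

Let F u v := randers_norm (h u) (b u) v.
Let alpha := rnorm (h x).

(** The partial derivative of F(., v) at x in the m-th coordinate. *)
Definition randers_norm_dx m v : R := bform (dh m) v v / (2 * rnorm (h x) v) + lform (db m) v.

Lemma is_derive_randers_norm_dx m v : v != 0 -> is_derive x 'e_m (F ^~ v) (randers_norm_dx m v).
Proof.
move=> v0.
have D1 := is_derive_comp1 (f := fun u => bform (h u) v v) (is_derive1_sqrt (hp.2 _ v0))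
  (is_derive_bform (Dh m) (is_derive_const v x _) (is_derive_const v x _)).
have D2 := is_derive_lform (Db m) (is_derive_const v x _).
apply: (is_derive_eq (is_derive_fun_add D1 D2)).
rewrite bform0l bform0r !addr0 /randers_norm_dx mulrC; congr (_ + _).
by rewrite [lform (b x) 0]/lform trmx0 mulmx0 mxE addr0.
Qed.

Lemma is_derive_randers_norm_dxdy m v w : v != 0 -> is_derive v w (randers_norm_dx m)
  (bform (dh m) v w / alpha v - bform (dh m) v v * bform (h x) v w / (2 * alpha v ^+ 3)
   + lform (db m) w).
Proof.
move=> v0; have a0 := rnorm_gt0 hp v0.
have D1 := is_derive_bform (is_derive_const (dh m) v w) (is_derive_id v w) (is_derive_id v w).
have a20 : 2 * rnorm (h x) v != 0 by rewrite mulf_neq0 ?gt_eqF.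
have D2 := is_derive_comp1 (f := fun v => 2 * rnorm (h x) v) (phi := fun t => t^-1)
  (is_deriveV (f := id) a20 (is_derive_id (2 * rnorm (h x) v) 1))
  (is_derive_fun_scale 2 (is_derive_rnorm w hp v0)).
have D3 := is_derive_lform (is_derive_const (db m) v w) (is_derive_id v w).
apply: (is_derive_eq (is_derive_fun_add (is_derive_fun_mul D1 D2) D3)).
rewrite [bform 0 v v]/bform [lform 0 v]/lform mulmx0 !mul0mx !mxE !add0r.
rewrite (bformC w v (dhT m)) -[_ *: 1]/(_ * 1) /alpha; congr (_ + _).
by field; rewrite gt_eqF.
Qed.

Definition dh_along (y : V) : 'M[R]_n := \sum_m y 0 m *: dh m.
Definition db_along (y : V) : V := \sum_m y 0 m *: db m.
(** [lower_spray] is twice the spray of h with its index lowered by h, so that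
    [riem_spray] has the coefficients 1/2 Gamma^i_jk y^j y^k. *)
Definition lower_spray (y : V) : V :=
  \row_l (bform (dh_along y) y 'e_l - 2^-1 * bform (dh l) y y).
Definition riem_spray (y : V) : V := 2^-1 *: (lower_spray y *m invmx (h x)).
(** b_(i|j) y^i y^j: the geodesic correction of the plain derivative of b along y is
    the value of b on twice the spray of h. *)
Definition r00 (y : V) : R := lform (db_along y) y - lform (b x) (2 *: riem_spray y).

Lemma bform_dh_along y v w : bform (dh_along y) v w = \sum_m y 0 m * bform (dh m) v w.
Proof.
rewrite /bform /dh_along mulmx_sumr mulmx_suml summxE; apply: eq_bigr => m _.
by rewrite -scalemxAr -scalemxAl mxE.
Qed.

Lemma lform_db_along y v : lform (db_along y) v = \sum_m y 0 m * lform (db m) v.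
Proof.
rewrite /lform /db_along mulmx_suml summxE; apply: eq_bigr => m _.
by rewrite -scalemxAl mxE.
Qed.

Lemma lower_spray_self y : lform (lower_spray y) y = 2^-1 * bform (dh_along y) y y.
Proof.
have -> : lform (lower_spray y) y = \sum_l y 0 l * bform (dh_along y) y 'e_l
    - 2^-1 * \sum_l y 0 l * bform (dh l) y y.
  rewrite lformE mulr_sumr -sumrB; apply: eq_bigr => l _; rewrite mxE; ring.
rewrite -bform_dh_along.
have -> : \sum_l y 0 l * bform (dh_along y) y 'e_l = bform (dh_along y) y y.
  rewrite [in RHS]bform_lform lformE; apply: eq_bigr => l _.
  by rewrite bform_lform lform_delta.
by lra.
Qed.

Lemma bform_riem_spray y w : bform (h x) (2 *: riem_spray y) w = lform (lower_spray y) w.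
Proof.
rewrite bform_lform /riem_spray scalerA mulfV// scale1r -mulmxA mulVmx ?mulmx1//.
exact: posdef_unit.
Qed.

Lemma bform_row (q : 'M[R]_n) (v : V) l : bform q 'e_l v = (q *m v^T) l 0.
Proof. by rewrite /bform -rowE -row_mul mxE. Qed.

(** The candidate is checked rather than solved for.  The fundamental tensor g maps
    4 G_alpha to the right-hand side of the spray equation except for the term
    2 r_00 dF, with dF the derivative of F in y, and since it maps y to F dF, the
    multiple P y supplies exactly that term. *)
Lemma spray_coef_randers y i : y != 0 ->
  spray_coef F i x y = riem_spray y 0 i + r00 y / (2 * F x y) * y 0 i.
Proof.
move=> y0; rewrite /spray_coef fundamental_tensor_randers//.
set g := randers_metric _ _ _; set P := r00 y / _.
have Fy : F x y != 0 by rewrite gt_eqF// F_gt0.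
have gu : g \in unitmx by exact: randers_metric_unit.
have a0 : alpha y != 0 by rewrite gt_eqF// rnorm_gt0.
have DF2 m v : v != 0 -> 'D_'e_m (fun u => F u v ^+ 2) x = 2 * (F x v * randers_norm_dx m v).
  move=> v0; have D := is_derive_randers_norm_dx m v0.
  have [_ ->] := is_derive_fun_mul D D; ring.
pose G := riem_spray y + P *: y.
have W l : \sum_m 'D_'e_l (fun v => 'D_'e_m (fun u => F u v ^+ 2) x) y * y 0 m
     - 'D_'e_l (fun u => F u y ^+ 2) x = 4 * bform g 'e_l G.
  have D2 m : 'D_'e_l (fun v => 'D_'e_m (fun u => F u v ^+ 2) x) y =
      2 * (randers_norm_dy (h x) (b x) y 'e_l * randers_norm_dx m y + F x y *
       (bform (dh m) y 'e_l / alpha y - bform (dh m) y y * bform (h x) y 'e_l / (2 * alpha y ^+ 3)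
        + lform (db m) 'e_l)).
    have -> : 'D_'e_l (fun v => 'D_'e_m (fun u => F u v ^+ 2) x) y =
        'D_'e_l (fun v => 2 * (F x v * randers_norm_dx m v)) y.
      by apply: near_eq_derive; apply: filterS (near_neq0 y0) => v; exact: DF2.
    by have [_ ->] := is_derive_fun_scale 2 (is_derive_fun_mul (is_derive_randers_norm (b x) 'e_l hp y0)
      (is_derive_randers_norm_dxdy m 'e_l y0)).
  rewrite DF2//; under eq_bigr do rewrite D2.
  set dF := randers_norm_dy _ _ _ _; set yl := bform (h x) y 'e_l.
  have -> : \sum_m 2 * (dF * randers_norm_dx m y + F x y *
       (bform (dh m) y 'e_l / alpha y - bform (dh m) y y * yl / (2 * alpha y ^+ 3)
        + lform (db m) 'e_l)) * y 0 m =
     2 * dF * (bform (dh_along y) y y / (2 * alpha y) + lform (db_along y) y)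
     + 2 * F x y * (bform (dh_along y) y 'e_l / alpha y
        - bform (dh_along y) y y * yl / (2 * alpha y ^+ 3) + lform (db_along y) 'e_l).
    rewrite !bform_dh_along !lform_db_along !mulr_suml -!sumrN -!big_split/= !mulr_sumr.
    rewrite -big_split/=; apply: eq_bigr => m _; rewrite /randers_norm_dx -/(alpha y).
    by field.
  (* The only place where the 1-form has to be closed. *)
  have -> : lform (db_along y) 'e_l = lform (db l) y.
    by rewrite lform_db_along lformE; apply: eq_bigr => m _; rewrite lform_delta closed.
  have lowl : lform (lower_spray y) 'e_l = bform (dh_along y) y 'e_l - 2^-1 * bform (dh l) y y.
    by rewrite lform_delta mxE.
  have hG w : bform (h x) (riem_spray y) w = 2^-1 * lform (lower_spray y) w.
    by rewrite -bform_riem_spray bformZl mulrA mulVf// mul1r.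
  have bG : lform (b x) (riem_spray y) = 2^-1 * (lform (db_along y) y - r00 y).
    by rewrite /r00 lformZr; field.
  have dFy : randers_norm_dy (h x) (b x) y y = F x y.
    by rewrite /randers_norm_dy /F /randers_norm -sqr_rnorm// -/(alpha y) expr2 mulfK.
  rewrite /g bform_randers_metric -/(F x y) -/(alpha y) -/dF /G.
  move: (riem_spray y) hG bG => S hG bG.
  have -> : randers_norm_dy (h x) (b x) y (S + P *: y) =
      4^-1 * bform (dh_along y) y y / alpha y + 2^-1 * (lform (db_along y) y - r00 y) + P * F x y.
    rewrite -dFy /randers_norm_dy !bformDr !lformDr !bformZr !lformZr bG (bformC y S hp.1).
    by rewrite hG lower_spray_self -/(alpha y); field.
  rewrite !bformDr !bformZr (bformC 'e_l S hp.1) (bformC y S hp.1).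
  rewrite !hG lowl lower_spray_self (bformC 'e_l y hp.1) -/yl -(sqr_rnorm y hp) -/(alpha y).
  by rewrite /randers_norm_dx -/(alpha y) /P; field; rewrite Fy.
under eq_bigr do rewrite W bform_row.
have -> : \sum_l invmx g i l * (4 * (g *m G^T) l 0) = 4 * (invmx g *m (g *m G^T)) i 0.
  by rewrite [in RHS]mxE mulr_sumr; apply: eq_bigr => l _; rewrite mulrCA.
by rewrite mulKmx// mulrA mulVf// mul1r !mxE.
Qed.

Lemma bform_coordl (q : 'M[R]_n) y w : bform q y w = \sum_m y 0 m * bform q 'e_m w.
Proof.
rewrite {1}(row_sum_delta y) /bform !mulmx_suml summxE; apply: eq_bigr => m _.
by rewrite -!scalemxAl mxE.
Qed.

Lemma bform_coordr (q : 'M[R]_n) y w : bform q w y = \sum_m y 0 m * bform q w 'e_m.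
Proof.
rewrite bform_lform lformE; apply: eq_bigr => m _; by rewrite bform_lform lform_delta.
Qed.

Lemma dh_along_delta m : dh_along 'e_m = dh m.
Proof.
rewrite /dh_along (bigD1 m)//= big1 => [|k km]; first by rewrite mxE !eqxx scale1r addr0.
by rewrite mxE eqxx (negbTE km) scale0r.
Qed.

Lemma db_along_delta m : db_along 'e_m = db m.
Proof.
rewrite /db_along (bigD1 m)//= big1 => [|k km]; first by rewrite mxE !eqxx scale1r addr0.
by rewrite mxE eqxx (negbTE km) scale0r.
Qed.

Lemma is_derive_coord y w m : is_derive y w (fun v : V => v 0 m) (w 0 m).
Proof. exact: (is_derive_mxP id y w w).1. Qed.

Lemma is_derive_dh_along y w : is_derive y w dh_along (dh_along w).
Proof.
apply/is_derive_mxP => i j; rewrite summxE; under eq_bigr do rewrite mxE.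
have -> : (fun v => dh_along v i j) = (fun v => \sum_m dh m i j * v 0 m).
  by apply/funext => v; rewrite summxE; apply: eq_bigr => m _; rewrite mxE mulrC.
under eq_bigr do rewrite mulrC.
by apply: is_derive_fun_sum => m; apply: is_derive_fun_scale; exact: is_derive_coord.
Qed.

Lemma is_derive_db_along y w : is_derive y w db_along (db_along w).
Proof.
apply/is_derive_mxP => i j; rewrite summxE; under eq_bigr do rewrite mxE.
have -> : (fun v => db_along v i j) = (fun v => \sum_m db m i j * v 0 m).
  by apply/funext => v; rewrite summxE; apply: eq_bigr => m _; rewrite mxE mulrC.
under eq_bigr do rewrite mulrC.
by apply: is_derive_fun_sum => m; apply: is_derive_fun_scale; exact: is_derive_coord.
Qed.

Lemma dh_alongT y : (dh_along y)^T = dh_along y.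
Proof.
rewrite /dh_along linear_sum/=; apply: eq_bigr => m _; by rewrite linearZ/= dhT.
Qed.

(** The derivative of [lower_spray] at y in the direction w; [dr00] below plays the
    same role for [r00]. *)
Definition dlower_spray (y w : V) : V :=
  \row_l (bform (dh_along w) y 'e_l + bform (dh_along y) w 'e_l - bform (dh l) y w).

Lemma is_derive_lower_spray y w : is_derive y w lower_spray (dlower_spray y w).
Proof.
apply/is_derive_mxP => i l; rewrite ord1 mxE; under eq_fun do rewrite mxE.
have D1 := is_derive_bform (is_derive_dh_along y w) (is_derive_id y w) (is_derive_const 'e_l y w).
have D2 := is_derive_bform (is_derive_const (dh l) y w) (is_derive_id y w) (is_derive_id y w).
apply: (is_derive_eq (is_derive_fun_sub D1 (is_derive_fun_scale 2^-1 D2))).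
rewrite bform0r [bform 0 _ _]/bform mulmx0 mul0mx mxE (bformC w y (dhT l)); by field.
Qed.

(** Euler's identity for a form of degree two; likewise [dr00_self]. *)
Lemma dlower_spray_self (y : V) : \sum_m y 0 m *: dlower_spray y 'e_m = 2 *: lower_spray y.
Proof.
apply/rowP => l; rewrite summxE !mxE.
under eq_bigr do rewrite !mxE dh_along_delta mulrBr mulrDr.
rewrite sumrB big_split/= -bform_dh_along -bform_coordl -bform_coordr; by field.
Qed.

Lemma riem_spray2 y : 2 *: riem_spray y = lower_spray y *m invmx (h x).
Proof. by rewrite scalerA mulfV// scale1r. Qed.

Definition dr00 (y w : V) : R := lform (db_along w) y + lform (db_along y) w
  - lform (b x) (dlower_spray y w *m invmx (h x)).

Lemma is_derive_r00 y w : is_derive y w r00 (dr00 y w).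
Proof.
have -> : r00 = (fun v => lform (db_along v) v - lform (b x) (lower_spray v *m invmx (h x))).
  by apply/funext => v; rewrite /r00 riem_spray2.
have D1 := is_derive_lform (is_derive_db_along y w) (is_derive_id y w).
have D2 := is_derive_lform (is_derive_const (b x) y w)
  (is_derive_mulmx (is_derive_lower_spray y w) (is_derive_const (invmx (h x)) y w)).
apply: (is_derive_eq (is_derive_fun_sub D1 D2)).
by rewrite mulmx0 addr0 [lform 0 _]/lform mul0mx mxE add0r.
Qed.

Lemma dr00_self (y : V) : \sum_m y 0 m * dr00 y 'e_m = 2 * r00 y.
Proof.
rewrite /dr00; under eq_bigr do rewrite mulrBr mulrDr db_along_delta.
rewrite sumrB big_split/= -lform_db_along.
have -> : \sum_m y 0 m * lform (db_along y) 'e_m = lform (db_along y) y.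
  by rewrite [RHS]lformE; apply: eq_bigr => m _; rewrite lform_delta.
have -> : \sum_m y 0 m * lform (b x) (dlower_spray y 'e_m *m invmx (h x)) =
   lform (b x) (2 *: (lower_spray y *m invmx (h x))).
  rewrite scalemxAl -dlower_spray_self mulmx_suml /lform linear_sum mulmx_sumr summxE.
  by apply: eq_bigr => m _; rewrite -scalemxAl linearZ -scalemxAr [RHS]mxE.
by rewrite lformZr /r00 riem_spray2; ring.
Qed.

(** In the trace against the symmetric matrix h^-1 the first and the last term of
    [dlower_spray] cancel. *)
Lemma div_riem_spray (y : V) :
  \sum_m 2^-1 * (dlower_spray y 'e_m *m invmx (h x)) 0 m =
  2^-1 * \tr (dh_along y *m invmx (h x)).
Proof.
rewrite -mulr_sumr; congr (_ * _).
have hiT : (invmx (h x))^T = invmx (h x) by rewrite trmx_inv hp.1.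
have E m : (dlower_spray y 'e_m *m invmx (h x)) 0 m =
    \sum_l bform (dh m) y 'e_l * invmx (h x) l m
    - \sum_l bform (dh l) y 'e_m * invmx (h x) l m
    + (dh_along y *m invmx (h x)) m m.
  rewrite !mxE -sumrB -big_split/=; apply: eq_bigr => l _.
  by rewrite mxE dh_along_delta bform_delta; ring.
under eq_bigr do rewrite E.
rewrite big_split/= sumrB [X in _ - X]exchange_big/=.
rewrite [X in X - _](_ : _ = \sum_j \sum_i bform (dh j) y 'e_i * invmx (h x) i j)//.
rewrite [X in _ - X](_ : _ = \sum_j \sum_i bform (dh j) y 'e_i * invmx (h x) i j) ?subrr ?add0r//.
by apply: eq_bigr => j _; apply: eq_bigr => i _; rewrite -[in LHS]hiT mxE.
Qed.

(** P = r00 / (2 F) is homogeneous of degree one in y, so by Euler's identity the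
    vector P y has divergence P + n P. *)
Lemma div_spray_coef (y : V) : y != 0 ->
  \sum_m 'D_'e_m (fun v => spray_coef F m x v) y =
  2^-1 * \tr (dh_along y *m invmx (h x)) + n.+1%:R * (r00 y / (2 * F x y)).
Proof.
move=> y0; have Fy : F x y != 0 by rewrite gt_eqF// F_gt0.
have F2y : 2 * F x y != 0 by rewrite mulf_neq0.
pose dP w := dr00 y w / (2 * F x y) - r00 y * randers_norm_dy (h x) (b x) y w / (2 * F x y ^+ 2).
have DP w : is_derive y w (fun v => r00 v / (2 * F x v)) (dP w).
  have D2 := is_derive_comp1 (f := fun v => 2 * F x v) (phi := fun t => t^-1)
    (is_deriveV (f := id) F2y (is_derive_id (2 * F x y) 1))
    (is_derive_fun_scale 2 (is_derive_randers_norm (b x) w hp y0)).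
  apply: (is_derive_eq (is_derive_fun_mul (is_derive_r00 y w) D2)).
  by rewrite /dP -[_ *: 1]/(_ * 1); field.
have E m : 'D_'e_m (fun v => spray_coef F m x v) y =
   2^-1 * (dlower_spray y 'e_m *m invmx (h x)) 0 m
   + (y 0 m * dP 'e_m + r00 y / (2 * F x y)).
  have -> : 'D_'e_m (fun v => spray_coef F m x v) y =
     'D_'e_m (fun v => 2^-1 * (lower_spray v *m invmx (h x)) 0 m + r00 v / (2 * F x v) * v 0 m) y.
    apply: near_eq_derive; apply: filterS (near_neq0 y0) => v v0.
    by rewrite spray_coef_randers// [riem_spray v 0 m]mxE.
  have /is_derive_mxP/(_ 0 m) D1 := is_derive_mulmx (is_derive_lower_spray y 'e_m)
    (is_derive_const (invmx (h x)) y 'e_m).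
  have [_ ->] := is_derive_fun_add (is_derive_fun_scale 2^-1 D1)
    (is_derive_fun_mul (DP 'e_m) (is_derive_coord y 'e_m m)).
  by rewrite mulmx0 addr0 [delta_mx 0 m 0 m]mxE !eqxx mulr1 (mulrC (dP _)).
under eq_bigr do rewrite E.
rewrite !big_split/= div_riem_spray sumr_const card_ord; congr (_ + _).
have -> : \sum_m y 0 m * dP 'e_m = r00 y / (2 * F x y).
  rewrite /dP; under eq_bigr do rewrite mulrBr !mulrA.
  rewrite sumrB -!mulr_suml dr00_self.
  have -> : \sum_m y 0 m * r00 y * randers_norm_dy (h x) (b x) y 'e_m = r00 y * F x y.
    under eq_bigr do rewrite (mulrC (y 0 _)) -mulrA.
    rewrite -mulr_sumr; congr (_ * _).
    rewrite /randers_norm_dy; under eq_bigr do rewrite mulrDr mulrA.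
    rewrite big_split/= -mulr_suml -bform_coordr -sqr_rnorm// expr2 mulfK; last by rewrite gt_eqF// rnorm_gt0.
    by congr (_ + _); rewrite [RHS]lformE; apply: eq_bigr => m _; rewrite lform_delta.
  by field.
by rewrite [RHS]mulr_natl [RHS]mulrS.
Qed.

End Spray.

(** * The S-curvature of a Randers metric of constant length *)

Lemma volume_unit_ball (R : realType) n :
  volume [set v : 'rV[R]_n | \sum_i v 0 i ^+ 2 < 1] = (ball_const R n)%:E.
Proof.
have E v : bform (1%:M : 'M[R]_n) v v = \sum_i v 0 i ^+ 2.
  by rewrite bform_lform mulmx1 lformE; apply: eq_bigr => i _; rewrite expr2.
have p1 : posdef (1%:M : 'M[R]_n).
  split; first exact: trmx1.
  move=> v v0; rewrite E lt_neqAle sumr_ge0 ?andbT; last by move=> i _; exact: sqr_ge0.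
  rewrite eq_sym psumr_neq0; last by move=> i _; exact: sqr_ge0.
  have /rV0Pn[i vi] := v0.
  by apply/hasP; exists i; rewrite ?mem_index_enum//= lt_neqAle sqr_ge0 andbT eq_sym sqrf_eq0.
have := volume_ellipsoid 0 1 p1; rewrite det1 sqrtr1 divr1 /ball_profile ltr01 sqrtr1 expr1n mulr1.
by move=> <-; congr volume; apply/seteqP; split => v /=; rewrite subr0 E.
Qed.

Lemma is_derive_sqrt_det (R : realType) (V : normedModType R) n (h : V -> 'M[R]_n) x w dh :
  posdef (h x) -> is_derive x w h dh ->
  is_derive x w (fun u => Num.sqrt (\det (h u)))
    (Num.sqrt (\det (h x)) * (2^-1 * \tr (dh *m invmx (h x)))).
Proof.
move=> hp Dh; have d0 := posdef_det_gt0 hp.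
have D := is_derive_comp1 (f := fun u => \det (h u)) (is_derive1_sqrt d0) (is_derive_det Dh).
apply: (is_derive_eq D).
rewrite /invmx posdef_unit// -scalemxAr mxtraceZ.
have s0 : Num.sqrt (\det (h x)) != 0 by rewrite gt_eqF// sqrtr_gt0.
have dE : \det (h x) = Num.sqrt (\det (h x)) ^+ 2 by rewrite sqr_sqrtr// ltW.
by move: s0 dE; set s := Num.sqrt _ => s0 ->; field.
Qed.

Section SCurvature.
Context {R : realType} {n : nat}.
Local Notation V := 'rV[R]_n.
Local Notation "''e_' i" := (delta_mx 0 i : V) (at level 8, i at level 2).
Variables (h : V -> 'M[R]_n) (X : V -> V) (x : V) (B : R).
Variables (dh : 'I_n -> 'M[R]_n) (db : 'I_n -> V).
Let b u := X u *m h u.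
Hypothesis hp : \forall u \near x, posdef (h u).
Hypothesis XB : \forall u \near x, bform (h u) (X u) (X u) = B.
Hypothesis B_lt1 : B < 1.
Hypothesis Dh : forall m, is_derive x 'e_m h (dh m).
Hypothesis Db : forall m, is_derive x 'e_m b (db m).
Hypothesis closed : forall i j, db i 0 j = db j 0 i.

Let hpx : posdef (h x) := nbhs_singleton hp.

Let dhT m : (dh m)^T = dh m.
Proof.
have D := is_derive_trmx (Dh m).
have [_ <-] : is_derive x 'e_m h (dh m)^T.
  by apply: near_eq_is_derive D; apply: filterS hp => u [].
by case: (Dh m).
Qed.

Lemma randers_norm_gt0 v : v != 0 -> 0 < randers_norm (h x) (b x) v.
Proof.
move=> v0; have a0 := rnorm_gt0 hpx v0.
have := bform_cauchy (X x) v hpx; rewrite (nbhs_singleton XB) -sqr_rnorm//.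
rewrite bform_lform -/(b x) /randers_norm.
have : B * rnorm (h x) v ^+ 2 < rnorm (h x) v ^+ 2 by rewrite gtr_pMl// exprn_gt0.
move=> H1 H2; have : lform (b x) v ^+ 2 < rnorm (h x) v ^+ 2 by apply: le_lt_trans H1.
rewrite -(@ltr_sqrt _ _ (_ ^+ 2)) ?exprn_gt0// !sqrtr_sqr (gtr0_norm a0) ltr_norml => /andP[].
lra.
Qed.

Let F u v := randers_norm (h u) (b u) v.

(** The factor (1 - |X|^2)^((n + 1) / 2) of the density is constant near x. *)
Lemma busemann_hausdorff_near : \forall u \near x,
  busemann_hausdorff F u = Num.sqrt (1 - B) ^+ n.+1 * Num.sqrt (\det (h u)).
Proof.
near=> u.
have pu : posdef (h u) by near: u.
have Bu : bform (h u) (X u) (X u) = B by near: u.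
rewrite /busemann_hausdorff volume_unit_ball/=.
have := @volume_randers_ball R n (h u) (X u) pu.
rewrite Bu => /(_ B_lt1) ->/=.
have K0 : ball_const R n != 0 by rewrite gt_eqF// ball_const_gt0.
have s0 : Num.sqrt (1 - B) != 0 by rewrite gt_eqF// sqrtr_gt0 subr_gt0.
have d0 : Num.sqrt (\det (h u)) != 0 by rewrite gt_eqF// sqrtr_gt0 posdef_det_gt0.
by field; rewrite K0 d0 expf_neq0.
Unshelve. all: by end_near. Qed.

Lemma derive_ln_busemann_hausdorff m :
  'D_'e_m (fun u => ln (busemann_hausdorff F u)) x = 2^-1 * \tr (dh m *m invmx (h x)).
Proof.
have -> : 'D_'e_m (fun u => ln (busemann_hausdorff F u)) x =
   'D_'e_m (fun u => ln (Num.sqrt (1 - B) ^+ n.+1 * Num.sqrt (\det (h u)))) x.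
  by apply: near_eq_derive; apply: filterS busemann_hausdorff_near => u ->.
have s0 : 0 < Num.sqrt (1 - B) ^+ n.+1 by rewrite exprn_gt0// sqrtr_gt0 subr_gt0.
have d0 : 0 < Num.sqrt (\det (h x)) by rewrite sqrtr_gt0 posdef_det_gt0.
have [_ ->] := is_derive_comp1
  (f := fun u => Num.sqrt (1 - B) ^+ n.+1 * Num.sqrt (\det (h u)))
  (is_derive1_ln (mulr_gt0 s0 d0)) (is_derive_fun_scale _ (is_derive_sqrt_det hpx (Dh m))).
rewrite [X in _ * X]mulrA mulKf//; exact/lt0r_neq0/mulr_gt0.
Qed.

(** The logarithmic derivative of sqrt (det h) is exactly the divergence of the
    spray of h, so only (n + 1) P survives. *)
Theorem S_curvature_randers y : y != 0 ->
  S_curvature F x y = n.+1%:R * (r00 h b x dh db y / (2 * F x y)).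
Proof.
move=> y0; rewrite /S_curvature.
rewrite (div_spray_coef hpx randers_norm_gt0 Dh Db dhT closed y0).
under [X in _ - X]eq_bigr do rewrite derive_ln_busemann_hausdorff.
have -> : \sum_m y 0 m * (2^-1 * \tr (dh m *m invmx (h x))) =
    2^-1 * \tr (dh_along dh y *m invmx (h x)).
  rewrite /dh_along mulmx_suml raddf_sum/= mulr_sumr; apply: eq_bigr => m _.
  by rewrite -scalemxAl mxtraceZ mulrCA.
by rewrite addrAC subrr add0r.
Qed.

End SCurvature.

(** * Orthonormal frames *)

Lemma bform_bigl (R : realType) n (q : 'M[R]_n) (I : Type) (r : seq I) (f : I -> 'rV[R]_n) w :
  bform q (\sum_(i <- r) f i) w = \sum_(i <- r) bform q (f i) w.
Proof. by rewrite /bform !mulmx_suml summxE. Qed.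

Lemma bform_bigr (R : realType) n (q : 'M[R]_n) (I : Type) (r : seq I) (f : I -> 'rV[R]_n) w :
  bform q w (\sum_(i <- r) f i) = \sum_(i <- r) bform q w (f i).
Proof. by rewrite /bform linear_sum mulmx_sumr summxE. Qed.

Section Frame.
Context {R : realType} {n : nat}.
Local Notation V := 'rV[R]_n.
Local Notation "''e_' i" := (delta_mx 0 i : V) (at level 8, i at level 2).
Variables (U : set V) (h : V -> 'M[R]_n) (E : 'I_n -> V -> V) (x : V).
Hypothesis oU : open U.
Hypothesis Ux : U x.
Hypothesis hp : forall u, U u -> posdef (h u).
Hypothesis hC : Ck_on 1 U h.
Hypothesis EC : forall i, Ck_on 1 U (E i).
Hypothesis ortho : forall u, U u -> forall i j, bform (h u) (E i u) (E j u) = (i == j)%:R.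

(** When E is a frame of left invariant fields, these are all the left invariant
    fields. *)
Definition const_field (a : V) : V -> V := fun u => \sum_i a 0 i *: E i u.

Definition bracket (Y Z : V -> V) : V := 'D_(Y x) Z x - 'D_(Z x) Y x.

Let nU : \forall u \near x, U u := open_nbhs_nbhs (conj oU Ux).

Lemma is_derive_const_field a w :
  is_derive x w (const_field a) (\sum_i a 0 i *: 'D_w (E i) x).
Proof.
apply: is_derive_fun_sum => i; apply: is_deriveZ.
by have [D _] := C1_is_derive w oU Ux (EC i); exact: derivableP.
Qed.

Lemma derive_linear (Y : V -> V) w : Ck_on 1 U Y ->
  'D_w Y x = \sum_m w 0 m *: 'D_'e_m Y x.
Proof. by move=> YC; case: (C1_is_derive w oU Ux YC). Qed.

Lemma bform_const_field a c u : U u ->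
  bform (h u) (const_field a u) (const_field c u) = \sum_i a 0 i * c 0 i.
Proof.
move=> Uu; rewrite bform_bigl; apply: eq_bigr => i _.
rewrite bform_bigr (bigD1 i)//= big1 => [|j ji]; rewrite bformZl bformZr ortho//.
  by rewrite eqxx mulr1 addr0.
by rewrite eq_sym (negbTE ji) !mulr0.
Qed.

Lemma bracket_const_field a c :
  bracket (const_field a) (const_field c) =
  \sum_i \sum_j (a 0 i * c 0 j) *: bracket (E i) (E j).
Proof.
have D p q : 'D_(const_field p x) (const_field q) x =
    \sum_i \sum_j (p 0 i * q 0 j) *: 'D_(E i x) (E j) x.
  have [_ ->] := is_derive_const_field q (const_field p x).
  rewrite [RHS]exchange_big/=; apply: eq_bigr => j _.
  have -> : 'D_(const_field p x) (E j) x = \sum_i p 0 i *: 'D_(E i x) (E j) x.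
    rewrite (derive_linear (const_field p x) (EC j)).
    under [RHS]eq_bigr do rewrite derive_linear// scaler_sumr.
    rewrite [RHS]exchange_big/=; apply: eq_bigr => m _.
    under [RHS]eq_bigr do rewrite scalerA.
    rewrite -scaler_suml; congr (_ *: _).
    by rewrite /const_field summxE; apply: eq_bigr => i _; rewrite mxE.
  by rewrite scaler_sumr; apply: eq_bigr => i _; rewrite scalerA mulrC.
rewrite /bracket !D [X in _ - X]exchange_big/= -sumrB; apply: eq_bigr => i _.
rewrite -sumrB; apply: eq_bigr => j _.
by rewrite scalerBr (mulrC (c 0 j)).
Qed.

Variable lam : V.
Let X := const_field lam.
Let dh m := 'D_'e_m h x.
(* The partial derivatives at x of the 1-form dual to X. *)
Let db m := 'D_'e_m X x *m h x + X x *m dh m.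

Let Dh w : is_derive x w h (dh_along dh w).
Proof. exact: C1_is_derive hC. Qed.

Let Dhm m : is_derive x 'e_m h (dh m).
Proof. by have := Dh 'e_m; rewrite dh_along_delta. Qed.

Let DX w : is_derive x w X ('D_w X x).
Proof. by have [D _] := is_derive_const_field lam w; exact: derivableP. Qed.

Let DXsum w : 'D_w X x = \sum_m w 0 m *: 'D_'e_m X x.
Proof.
have [_ ->] := is_derive_const_field lam w.
under eq_bigr do rewrite derive_linear// scaler_sumr.
rewrite exchange_big/=; apply: eq_bigr => m _.
have [_ ->] := is_derive_const_field lam 'e_m; rewrite scaler_sumr.
by apply: eq_bigr => i _; rewrite !scalerA mulrC.
Qed.

Let Db w : is_derive x w (fun u => X u *m h u) (db_along db w).
Proof.
apply: (is_derive_eq (is_derive_mulmx (DX w) (Dh w))).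
rewrite DXsum /db_along /dh_along mulmx_suml mulmx_sumr -big_split/=.
by apply: eq_bigr => m _; rewrite -scalemxAl -scalemxAr -scalerDr.
Qed.

Let Dbm m : is_derive x 'e_m (fun u => X u *m h u) (db m).
Proof. by have := Db 'e_m; rewrite db_along_delta. Qed.

Let hpx : posdef (h x) := hp Ux.

Let dh_alongT w : (dh_along dh w)^T = dh_along dh w.
Proof.
have [_ <-] : is_derive x w h (dh_along dh w)^T.
  by apply: near_eq_is_derive (is_derive_trmx (Dh w)); apply: filterS nU => u /hp[].
by case: (Dh w).
Qed.

(** r_00 is half the Lie derivative of h along X, evaluated at (Y, Y).  Since
    h (Y, Y) is constant, the term in which h is differentiated along X can be traded
    for a derivative of Y along X, which completes the bracket. *)
Lemma r00_const_field a : let Y := const_field a in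
  r00 h (fun u => X u *m h u) x dh db (Y x) = bform (h x) (bracket Y X) (Y x).
Proof.
move=> Y.
(* The vanishing derivative of h (Y, Y) along X. *)
have Yc : bform (dh_along dh (X x)) (Y x) (Y x) = - 2 * bform (h x) ('D_(X x) Y x) (Y x).
  have DY : is_derive x (X x) Y ('D_(X x) Y x).
    by have [D _] := is_derive_const_field a (X x); exact: derivableP.
  have [_ D] := is_derive_bform (Dh (X x)) DY DY.
  have : 'D_(X x) (fun u => bform (h u) (Y u) (Y u)) x = 0.
    have [_ <-] := is_derive_const (\sum_i a 0 i * a 0 i) x (X x).
    by apply: near_eq_derive; apply: filterS nU => u; exact: bform_const_field.
  by rewrite D (bformC (Y x) _ hpx.1) => ?; lra.
rewrite /r00 -bform_lform (bformC _ _ hpx.1) (bform_riem_spray _ hpx).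
have -> : lform (db_along db (Y x)) (Y x) =
    bform (h x) ('D_(Y x) X x) (Y x) + bform (dh_along dh (Y x)) (X x) (Y x).
  have [_ <-] := Db (Y x).
  have [_ ->] := is_derive_mulmx (DX (Y x)) (Dh (Y x)).
  by rewrite /lform mulmxDl mxE.
have -> : lform (lower_spray dh (Y x)) (X x) =
    bform (dh_along dh (Y x)) (Y x) (X x) - 2^-1 * bform (dh_along dh (X x)) (Y x) (Y x).
  rewrite lformE [bform (dh_along dh (X x)) _ _]bform_dh_along.
  rewrite [bform _ _ (X x)]bform_coordr mulr_sumr -sumrB.
  apply: eq_bigr => l _; by rewrite mxE; ring.
have -> : bform (h x) (bracket Y X) (Y x) =
    bform (h x) ('D_(Y x) X x) (Y x) - bform (h x) ('D_(X x) Y x) (Y x).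
  by rewrite /bracket bformDl bformNl.
rewrite Yc (bformC (Y x) (X x) (dh_alongT _)).
move: (bform (h x) ('D_(Y x) X x) (Y x)) (bform (h x) ('D_(X x) Y x) (Y x)) => s t.
by move: (bform (dh_along dh (Y x)) (X x) (Y x)) => r; field.
Qed.

Let bracketC i j : bracket (E j) (E i) = - bracket (E i) (E j).
Proof. by rewrite /bracket opprB. Qed.

Let frame : 'M[R]_n := \matrix_i E i x.

Lemma frame_gram (q : 'M[R]_n) i j : (frame *m q *m frame^T) i j = bform q (E i x) (E j x).
Proof.
rewrite -[LHS]bform_delta /bform !mulmxA -rowE rowK -(mulmxA _ _ (_^T)) -trmx_mul -rowE rowK.
by [].
Qed.

Lemma frame_unit : frame \in unitmx.
Proof.
have : frame *m (h x *m frame^T) = 1%:M.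
  by apply/matrixP => i j; rewrite mulmxA frame_gram ortho// mxE.
by case/mulmx1_unit.
Qed.

(** The 1-form beta dual to X is constant on each E_j, so that
    d beta (E_i, E_j) = - beta [E_i, E_j].  Vanishing of d beta on all pairs from a
    basis is the symmetry of the matrix of partial derivatives, up to congruence. *)
Lemma closed_of_bracket :
  (forall i j : 'I_n, (i < j)%N -> bform (h x) (X x) (bracket (E i) (E j)) = 0) ->
  forall i j, db i 0 j = db j 0 i.
Proof.
move=> br.
(* d beta = 0 means that this Jacobian matrix of beta is symmetric. *)
pose M : 'M[R]_n := \matrix_(i, j) db i 0 j.
have ME u v : bform M u v = lform (db_along db u) v.
  rewrite bform_coordl lform_db_along; apply: eq_bigr => m _; congr (_ * _).
  by rewrite bform_coordr lformE; apply: eq_bigr => k _; rewrite bform_delta mxE.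
have XE u j : U u -> bform (h u) (X u) (E j u) = lam 0 j.
  move=> Uu; rewrite /X /const_field bform_bigl (bigD1 j)//= big1 => [|i ij].
    by rewrite bformZl ortho// eqxx mulr1 addr0.
  by rewrite bformZl ortho// (negbTE ij) mulr0.
have dbE i j : bform M (E i x) (E j x) = - bform (h x) (X x) ('D_(E i x) (E j) x).
  have DE : is_derive x (E i x) (E j) ('D_(E i x) (E j) x).
    by have [D _] := C1_is_derive (E i x) oU Ux (EC j); exact: derivableP.
  have [_ D] := is_derive_lform (Db (E i x)) DE.
  have : 'D_(E i x) (fun u => lform (X u *m h u) (E j u)) x = 0.
    have [_ <-] := is_derive_const (lam 0 j) x (E i x).
    by apply: near_eq_derive; apply: filterS nU => u Uu; rewrite -bform_lform XE.
  by rewrite D -bform_lform -ME => /eqP; rewrite addr_eq0 => /eqP.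
have sym i j : bform M (E i x) (E j x) = bform M (E j x) (E i x).
  apply/eqP; rewrite -subr_eq0 !dbE -opprD oppr_eq0 -bformNr -bformDr -/(bracket (E i) (E j)).
  have [ij|ji|/val_inj ->] := ltngtP i j; first by rewrite br.
    by rewrite bracketC bformNr br// oppr0.
  by rewrite /bracket subrr bform0r.
have MT : M = M^T.
  have : frame *m M *m frame^T = frame *m M^T *m frame^T.
    apply/matrixP => i j; rewrite [LHS]frame_gram sym -frame_gram.
    by rewrite -[LHS](mxE trmx_key (fun i j => _ j i)) -/(trmx _) !trmx_mul trmxK mulmxA.
  move/(can_inj (mulmxK _)) => H; apply: (can_inj (mulKmx frame_unit)).
  by apply: H; rewrite unitmx_tr frame_unit.
move=> i j; have : M i j = M^T i j by rewrite -MT.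
by rewrite [M^T i j]mxE [M i j]mxE [M j i]mxE.
Qed.

(** The double sum is the bracket of the two fields, by [bracket_const_field]. *)
Theorem S_curvature_const_field a :
  (forall i j : 'I_n, (i < j)%N -> bform (h x) (X x) (bracket (E i) (E j)) = 0) ->
  \sum_i lam 0 i ^+ 2 < 1 -> const_field a x != 0 ->
  let F u v := randers_norm (h u) (X u *m h u) v in let Y := const_field a x in
  S_curvature F x Y = n.+1%:R *
    (bform (h x) (\sum_i \sum_j (a 0 i * lam 0 j) *: bracket (E i) (E j)) Y / (2 * F x Y)).
Proof.
move=> br lam1 Y0 F Y.
have posn : \forall u \near x, posdef (h u) by apply: filterS nU => u; exact: hp.
have normX : \forall u \near x, bform (h u) (X u) (X u) = \sum_i lam 0 i ^+ 2.
  by apply: filterS nU => u Uu; rewrite /X bform_const_field//; under eq_bigr do rewrite -expr2.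
have SE := S_curvature_randers posn normX lam1 Dhm Dbm (closed_of_bracket br) Y0.
have r00E := r00_const_field a.
rewrite -bracket_const_field.
rewrite /= in r00E.
by rewrite r00E in SE.
Qed.

End Frame.

(** * Left invariant Randers metrics *)

(** The translation by p moves the identity to p and preserves the metric and the
    fields. *)
Lemma orthonormal_basis_everywhere (R : realType) n (G : lieGroupType R n)
    (h : tensor2 G) (E : n.-tuple (vfield G)) (c : chart R n G) :
  left_invariant_metric h -> orthonormal_basis h E -> atlas c -> chart_dom c 1%g ->
  forall u, chart_cod c u -> forall i j,
    pairing h c u (tnth E i c u) (tnth E j c u) = (i == j)%:R.
Proof.
move=> [_ hL] [EL Eo] ca c1 u [p cp <-] i j.
pose L (q : G) := (p * q)%g.
have e_dom : local_dom L c c (chart_map c 1%g) by exists 1%g => //; split; rewrite /L ?mulg1.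
have eL : local_map L c c (chart_map c 1%g) = chart_map c p.
  by rewrite /local_map chart_mapK// /L mulg1.
have EE k : tnth E k c (chart_map c p) =
    'D_(tnth E k c (chart_map c 1%g)) (local_map L c c) (chart_map c 1%g).
  by rewrite -eL; have [_ H] := EL k; apply: H.
by rewrite !EE -{1}eL hL// Eo.
Qed.

(** Allows replacing X by its expression in the frame, which holds only inside the
    image of the chart. *)
Lemma S_curvature_near (R : realType) n (F H : 'rV[R]_n -> 'rV[R]_n -> R) x y :
  (\forall u \near x, F u = H u) -> S_curvature F x y = S_curvature H x y.
Proof.
move=> FH; have FHx := nbhs_singleton FH.
pose dF2 (K : 'rV[R]_n -> 'rV[R]_n -> R) m v := 'D_(delta_mx 0 m) (fun u => K u v ^+ 2) x.
have D : dF2 F = dF2 H.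
  apply/funext => m; apply/funext => v; apply: near_eq_derive.
  by apply: filterS FH => u ->.
have S i v : spray_coef F i x v = spray_coef H i x v.
  have sprayE (K : 'rV[R]_n -> 'rV[R]_n -> R) : spray_coef K i x v =
    4^-1 * \sum_l invmx (fundamental_tensor (fun=> K x) x v) i l *
      (\sum_m 'D_(delta_mx 0 l) (dF2 K m) v * v 0 m - dF2 K l v) by [].
  by rewrite !sprayE D FHx.
have Dbh m : 'D_(delta_mx 0 m) (fun u => ln (busemann_hausdorff F u)) x =
    'D_(delta_mx 0 m) (fun u => ln (busemann_hausdorff H u)) x.
  by apply: near_eq_derive; apply: filterS FH => u Fu; rewrite /busemann_hausdorff Fu.
have DS m : 'D_(delta_mx 0 m) (fun v => spray_coef F m x v) y =
    'D_(delta_mx 0 m) (fun v => spray_coef H m x v) y.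
  by have -> : (fun v => spray_coef F m x v) = (fun v => spray_coef H m x v)
    by apply/funext => v; exact: S.
have S1 : \sum_m 'D_(delta_mx 0 m) (fun v => spray_coef F m x v) y =
    \sum_m 'D_(delta_mx 0 m) (fun v => spray_coef H m x v) y.
  by apply: eq_bigr => m _; exact: DS.
have S2 : \sum_m y 0 m * 'D_(delta_mx 0 m) (fun u => ln (busemann_hausdorff F u)) x =
    \sum_m y 0 m * 'D_(delta_mx 0 m) (fun u => ln (busemann_hausdorff H u)) x.
  by apply: eq_bigr => m _; rewrite Dbh.
exact: (f_equal2 (fun s t => s - t) S1 S2).
Qed.

(** With B the table of brackets of basis elements, this is the bracket of two
    combinations of them, the second one in the span of the first two. *)
Lemma skew_sum5 (R : realType) (V : lmodType R) (B : nat -> nat -> V) (l1 l2 y1 y2 y3 y4 y5 : R) :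
  (forall i, B i i = 0) -> (forall i j, B j i = - B i j) ->
  \sum_(i < 5) \sum_(j < 5)
    ([:: y1; y2; y3; y4; y5]`_i * [:: l1; l2; 0; 0; 0]`_j) *: B i j =
  (y1 * l2 - y2 * l1) *: B 0%N 1%N - y3 *: (l1 *: B 0%N 2%N + l2 *: B 1%N 2%N)
  - y4 *: (l1 *: B 0%N 3%N + l2 *: B 1%N 3%N) - y5 *: (l1 *: B 0%N 4%N + l2 *: B 1%N 4%N).
Proof.
move=> B0 BC.
rewrite !big_ord_recl !big_ord0 /= /bump /= !addn0 !add1n !mulr0 !scale0r !addr0 !B0 !scaler0.
rewrite !add0r !addr0 (BC 0%N 1%N) (BC 0%N 2%N) (BC 0%N 3%N) (BC 0%N 4%N).
rewrite (BC 1%N 2%N) (BC 1%N 3%N) (BC 1%N 4%N) !scalerN.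
by rewrite scalerBl !scalerDr !scalerA !opprD !addrA.
Qed.

Theorem theorem3p4 (R : realType) (G : lieGroupType R 5)
  (hsc : simply_connected R G) (hnil : nilpotent_group G)
  (h : tensor2 G) (hh : left_invariant_metric h)
  (a b c d f g : R) (E1 E2 E3 E4 E5 : vfield G)
  (hE : orthonormal_basis h [tuple E1; E2; E3; E4; E5])
  (h12 : eq_field (lie_bracket E1 E2) (a *: E3 + b *: E4 + c *: E5))
  (h13 : eq_field (lie_bracket E1 E3) (d *: E4 + f *: E5))
  (h14 : eq_field (lie_bracket E1 E4) (g *: E5))
  (h15 : eq_field (lie_bracket E1 E5) 0)
  (h23 : eq_field (lie_bracket E2 E3) 0)
  (h24 : eq_field (lie_bracket E2 E4) 0)
  (h25 : eq_field (lie_bracket E2 E5) 0)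
  (h34 : eq_field (lie_bracket E3 E4) 0)
  (h35 : eq_field (lie_bracket E3 E5) 0)
  (h45 : eq_field (lie_bracket E4 E5) 0)
  (ha : 0 < a) (hd : 0 < d) (hg : 0 < g) (hbf : 0 < b \/ b = 0 /\ 0 <= f)
  (X : vfield G) (hX : left_invariant_field X) (lam1 lam2 : R)
  (hXE : eq_field X (lam1 *: E1 + lam2 *: E2))
  (hX1 : forall ph : chart R 5 G, atlas ph -> forall x, chart_cod ph x ->
     riemannian_norm h ph x (X ph x) < 1)
  (hFinv : left_invariant_finsler (randers h X))
  (hFnr : ~ is_riemannian (randers h X))
  (hFD : douglas_type (randers h X))
  (y1 y2 y3 y4 y5 : R)
  (ph : chart R 5 G) (hph : atlas ph) (he : chart_dom ph 1%g) :
  let e := chart_map ph 1%g in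
  let Y := (y1 *: E1 + y2 *: E2 + y3 *: E3 + y4 *: E4 + y5 *: E5 : vfield G) ph e in
  let F := randers h X ph in
  Y != 0 ->
  S_curvature F e Y =
    3 * (((y1 * lam2 - y2 * lam1) * (a * y3 + b * y4 + c * y5)
          - lam1 * y3 * (d * y4 + f * y5) - lam1 * g * y4 * y5) / F e Y).
Proof.
move=> e Y F Y0.
pose E (i : 'I_5) := tnth [tuple E1; E2; E3; E4; E5] i ph.
pose lam : 'rV[R]_5 := \row_i [:: lam1; lam2; 0; 0; 0]`_i.
pose y : 'rV[R]_5 := \row_i [:: y1; y2; y3; y4; y5]`_i.
pose U := chart_cod ph.
have Ue : U e by exists 1%g.
have oU : open U by exact: chart_cod_open.
have [[hS hT hP _] _] := hh.
have hp u : U u -> posdef (h ph u).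
  by move=> Uu; split; [exact: hT|exact: hP].
have hC : Ck_on 1 U (h ph) by exact: hS.
have EC i : Ck_on 1 U (E i).
  by have [EL _] := hE; have [[ES _] _] := EL i; exact: ES.
have ortho := orthonormal_basis_everywhere hh hE hph he.
have YE : const_field E y e = Y.
  by rewrite /const_field !big_ord_recl big_ord0 !mxE/= /E !(tnth_nth E1)/= addr0 !addrA.
have XE u : U u -> X ph u = const_field E lam u.
  move=> Uu; rewrite hXE// /const_field !big_ord_recl big_ord0 !mxE/= /E !(tnth_nth E1)/=.
  by rewrite !scale0r !addr0.
have [B12 B13 B14 B15] := And4 (h12 ph hph e Ue) (h13 ph hph e Ue) (h14 ph hph e Ue) (h15 ph hph e Ue).
have [B23 B24 B25] := And3 (h23 ph hph e Ue) (h24 ph hph e Ue) (h25 ph hph e Ue).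
have [B34 B35 B45] := And3 (h34 ph hph e Ue) (h35 ph hph e Ue) (h45 ph hph e Ue).
have comb z1 z2 z3 z4 z5 : const_field E (\row_i [:: z1; z2; z3; z4; z5]`_i) e =
    z1 *: E1 ph e + z2 *: E2 ph e + z3 *: E3 ph e + z4 *: E4 ph e + z5 *: E5 ph e.
  by rewrite /const_field !big_ord_recl big_ord0 !mxE/= /E !(tnth_nth E1)/= addr0 !addrA.
(* The derived algebra lies in the span of E3, E4 and E5, orthogonal to X. *)
have ortho_derived p q r :
    bform (h ph e) (const_field E lam e) (p *: E3 ph e + q *: E4 ph e + r *: E5 ph e) = 0.
  have -> : p *: E3 ph e + q *: E4 ph e + r *: E5 ph e =
      const_field E (\row_i [:: 0; 0; p; q; r]`_i) e by rewrite comb !scale0r !add0r.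
  rewrite (bform_const_field ortho)// !big_ord_recl big_ord0 !mxE/=.
  by rewrite !mulr0 !mul0r !addr0.
have br (i j : 'I_5) : (i < j)%N -> bform (h ph e) (const_field E lam e) (bracket e (E i) (E j)) = 0.
  case: i => [[|[|[|[|[|//]]]]] i5]; case: j => [[|[|[|[|[|//]]]]] j5] //= _.
  all: rewrite /E ?(tnth_nth E1)/=.

  - by rewrite [bracket _ _ _]B12 ortho_derived.
  - by rewrite [bracket _ _ _]B13 -(ortho_derived 0 d f) scale0r add0r.
  - by rewrite [bracket _ _ _]B14 -(ortho_derived 0 0 g) !scale0r !add0r.
  - by rewrite [bracket _ _ _]B15 bform0r.
  - by rewrite [bracket _ _ _]B23 bform0r.
  - by rewrite [bracket _ _ _]B24 bform0r.
  - by rewrite [bracket _ _ _]B25 bform0r.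
  - by rewrite [bracket _ _ _]B34 bform0r.
  - by rewrite [bracket _ _ _]B35 bform0r.
  - by rewrite [bracket _ _ _]B45 bform0r.
have lam_lt1 : \sum_i lam 0 i ^+ 2 < 1.
  have := hX1 ph hph e Ue; rewrite /riemannian_norm -[X in X < _]/(rnorm (h ph e) (X ph e)).
  rewrite XE// => H; have : rnorm (h ph e) (const_field E lam e) ^+ 2 < 1.
    by rewrite expr_lt1// sqrtr_ge0.
  by rewrite sqr_rnorm ?(bform_const_field ortho)//; exact: hp.
rewrite (S_curvature_near (H := fun u v => randers_norm (h ph u) (const_field E lam u *m h ph u) v)); last first.
  apply: filterS (open_nbhs_nbhs (conj oU Ue)) => u Uu; apply/funext => v.
  by rewrite /F /randers /pairing XE.
rewrite -YE (S_curvature_const_field oU Ue hp hC EC ortho br lam_lt1); last by rewrite YE.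
have -> : F e (const_field E y e) =
    randers_norm (h ph e) (const_field E lam e *m h ph e) (const_field E y e).
  by rewrite /F /randers /pairing XE.
pose Es (k : nat) := nth E1 [:: E1; E2; E3; E4; E5] k ph.
have -> : \sum_i \sum_j (y 0 i * lam 0 j) *: bracket e (E i) (E j) =
    \sum_(i < 5) \sum_(j < 5) ([:: y1; y2; y3; y4; y5]`_i * [:: lam1; lam2; 0; 0; 0]`_j) *:
      bracket e (Es i) (Es j).
  apply: eq_bigr => i _; apply: eq_bigr => j _.
  by rewrite [y 0 i]mxE [lam 0 j]mxE /E !(tnth_nth E1).
rewrite (@skew_sum5 _ _ (fun i j => bracket e (Es i) (Es j))); last 2 first.
- by move=> i; rewrite /bracket subrr.
- by move=> i j; rewrite /bracket opprB.
have -> : bracket e (Es 0%N) (Es 1%N) = a *: E3 ph e + b *: E4 ph e + c *: E5 ph e by exact: B12.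
have -> : bracket e (Es 0%N) (Es 2%N) = d *: E4 ph e + f *: E5 ph e by exact: B13.
have -> : bracket e (Es 0%N) (Es 3%N) = g *: E5 ph e by exact: B14.
have -> : bracket e (Es 0%N) (Es 4%N) = 0 by exact: B15.
have -> : bracket e (Es 1%N) (Es 2%N) = 0 by exact: B23.
have -> : bracket e (Es 1%N) (Es 3%N) = 0 by exact: B24.
have -> : bracket e (Es 1%N) (Es 4%N) = 0 by exact: B25.
set p := y1 * lam2 - y2 * lam1.
have -> : p *: (a *: E3 ph e + b *: E4 ph e + c *: E5 ph e)
    - y3 *: (lam1 *: (d *: E4 ph e + f *: E5 ph e) + lam2 *: 0)
    - y4 *: (lam1 *: (g *: E5 ph e) + lam2 *: 0) - y5 *: (lam1 *: 0 + lam2 *: 0) =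
    const_field E (\row_i [:: 0; 0; p * a; p * b - lam1 * y3 * d;
      p * c - lam1 * y3 * f - lam1 * y4 * g]`_i) e.
  rewrite comb; move: (E1 ph e) (E2 ph e) (E3 ph e) (E4 ph e) (E5 ph e) => v1 v2 v3 v4 v5.
  by apply/rowP => k; rewrite !mxE; ring.
rewrite (bform_const_field ortho)//.
have -> : \sum_(i < 5) (\row_i [:: 0; 0; p * a; p * b - lam1 * y3 * d;
      p * c - lam1 * y3 * f - lam1 * y4 * g]`_i) 0 i * y 0 i =
   p * (a * y3 + b * y4 + c * y5) - lam1 * y3 * (d * y4 + f * y5) - lam1 * g * y4 * y5.
  under eq_bigr do rewrite [y 0 _]mxE mxE.
  by rewrite !big_ord_recl big_ord0/=; ring.
by rewrite invfM; move: (randers_norm _ _ _)^-1 => r; field.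
Qed.
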